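(* Let $\Bbbk$ be a field and let $A, B$ be standard graded polynomial rings over $\Bbbk$. Let $I\subseteq A$ and $J\subseteq B$ be nonzero proper homogeneous ideals, and let $I+J$ denote the ideal of $A\otimes_\Bbbk B$ generated by $I$ and $J$. Then $$\max\{\rho(I),\rho(J)\}\le \rho(I+J)\le \max\left\{\rho(I),\rho(J),\frac{2(\rho(I)+\rho(J))}{3}\right\},$$ and the upper bound is sharp (i.e. there exist such $A,B,I,J$ for which $\rho(I+J)$ equals the right-hand side). In particular, if $\max\{\rho(I),\rho(J)\}\ge 2\min\{\rho(I),\rho(J)\}$, then $\rho(I+J)=\max\{\rho(I),\rho(J)\}$.
   Context: A standard graded polynomial ring over $\Bbbk$ is a polynomial ring in finitely many variables over $\Bbbk$, all variables having degree 1. $A\otimes_\Bbbk B$ is the polynomial ring over $\Bbbk$ in the disjoint union of the variables of $A$ and $B$. For an ideal $I$ of a noetherian ring $A$ and $n\ge 1$, the $n$-th symbolic power (defined via associated primes) is $I^{(n)}=\bigcap_{\mathfrak p\in \operatorname{Ass}(I)}(I^nA_{\mathfrak p}\cap A)$, where $\operatorname{Ass}(I)$ is the set of associated primes of $A/I$ and $I^nA_{\mathfrak p}\cap A$ is the preimage of $I^nA_{\mathfrak p}$ in $A$. The resurgence of a nonzero proper homogeneous ideal $I$ in a polynomial ring is $\rho(I)=\sup\{\frac{m}{r}: I^{(m)}\not\subseteq I^r,\ m\ge 1,\ r\ge 1\}$ ($m,r$ integers). *)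

(* Defs.v *)
From HB Require Import structures.
From mathcomp Require Import all_boot all_order all_algebra.
From mathcomp Require Import fraction mpoly.
From mathcomp Require Import boolp classical_sets reals constructive_ereal ereal.

Set Implicit Arguments.
Unset Strict Implicit.
Unset Printing Implicit Defensive.

Import Order.TTheory GRing.Theory Num.Theory.

Local Open Scope classical_set_scope.
Local Open Scope ring_scope.

Local Notation "x %:F" := (tofrac x) : ring_scope.

(* Ideals are Prop-valued sets rather than the decidable, necessarily proper
   ideals of ring_quotient, since sums, products and symbolic powers of ideals
   over an arbitrary field have no boolean membership test. *)
Section Ideals.
Variable A : idomainType.
Implicit Types (I J P : set A).

Definition is_ideal I : Prop :=
  [/\ I 0, (forall x y, I x -> I y -> I (x + y))
    & (forall a x, I x -> I (a * x))].

Definition is_prime_ideal P : Prop :=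
  [/\ is_ideal P, ~ P 1 & forall x y, P (x * y) -> P x \/ P y].

Definition ideal_gen (S : set A) : set A := smallest is_ideal S.

Definition ideal_mul I J : set A :=
  ideal_gen [set z | exists x y, [/\ I x, J y & z = x * y]].

Fixpoint ideal_exp I (n : nat) : set A :=
  if n is n'.+1 then ideal_mul I (ideal_exp I n') else setT.

(* P is the annihilator of the class of some x in A / I. *)
Definition associated_prime I P : Prop :=
  is_prime_ideal P /\ exists x, P = [set a | I (a * x)].

(* A being a domain, its localization at a prime P is realised as a subring of
   the fraction field. *)
Definition localization P : set {fraction A} :=
  [set u | exists x s : A, ~ P s /\ u = x%:F / s%:F].

(* I A_P: the finite A_P-linear combinations of images of elements of I. *)
Definition extension P I : set {fraction A} :=
  [set z | exists (l : nat) (u : 'I_l -> {fraction A}) (a : 'I_l -> A),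
     [/\ forall j, localization P (u j), forall j, I (a j)
       & z = \sum_(j < l) u j * (a j)%:F]].

Definition contraction P I : set A := [set a | extension P I a%:F].

Definition symbolic_power I (n : nat) : set A :=
  \bigcap_(P in associated_prime I) contraction P (ideal_exp I n).

(* Valued in the extended reals, so that no finiteness is presupposed. *)
Definition resurgence (R : realType) I : \bar R :=
  ereal_sup [set q | exists m r : nat,
    [/\ (0 < m)%N, (0 < r)%N, ~ (symbolic_power I m `<=` ideal_exp I r)
      & q = (m%:R / r%:R)%:E]].

End Ideals.

Section PolynomialRings.
Variable k : fieldType.

(* pihomog mdeg d p is the homogeneous component of p of standard degree d. *)
Definition homogeneous_ideal n (I : set {mpoly k[n]}) : Prop :=
  is_ideal I /\ forall (d : nat) p, I p -> I (pihomog mdeg d p).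

Definition nonzero_proper_homogeneous n (I : set {mpoly k[n]}) : Prop :=
  [/\ homogeneous_ideal I, (exists2 p, I p & p != 0) & ~ I 1].

(* {mpoly k[n + m]} stands for the tensor product of {mpoly k[n]} and
   {mpoly k[m]}: the first n variables come from the left factor, the last m
   from the right one. *)
Definition tensor_inl n m (p : {mpoly k[n]}) : {mpoly k[n + m]} :=
  p \mPo [tuple 'X_(lshift m i) | i < n].

Definition tensor_inr n m (p : {mpoly k[m]}) : {mpoly k[n + m]} :=
  p \mPo [tuple 'X_(rshift n j) | j < m].

Definition ideal_sum n m (I : set {mpoly k[n]}) (J : set {mpoly k[m]}) :
    set {mpoly k[n + m]} :=
  ideal_gen ((@tensor_inl n m @` I) `|` (@tensor_inr n m @` J)).

End PolynomialRings.

(* Main.v *)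
Require Import Defs.
From HB Require Import structures.
From mathcomp Require Import all_boot all_order all_algebra.
From mathcomp Require Import fraction mpoly.
From mathcomp Require Import boolp classical_sets reals constructive_ereal ereal.
From mathcomp Require ssrcomplements.
From mathcomp Require Import ring lra zify.

Set Implicit Arguments.
Unset Strict Implicit.
Unset Printing Implicit Defensive.

Import Order.TTheory GRing.Theory Num.Theory.

Local Open Scope classical_set_scope.
Local Open Scope ring_scope.

(** The resurgence of a sum is controlled by the binomial expansion of its
    symbolic powers: the m-th symbolic power of I + J is the sum of the products
    of the i-th symbolic power of I and the j-th one of J, for i + j = m. Only
    one inclusion is needed (symbolic_power_sum_sub).

    Lower bound: the associated primes of I + J contract to associated primes of
    I (associated_prime_preimage), so symbolic powers of I extend into those of
    I + J, and setting the variables of B to 0 maps the powers of I + J into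
    those of I.

    Upper bound: let the m-th symbolic power of I + J not lie in its r-th power.
    The expansion provides i + j = m for which the product of the i-th symbolic
    power of I and the j-th one of J is not in that r-th power. With a and b the
    largest exponents such that these two symbolic powers lie in I^a and J^b, it
    follows that a + b < r, while i <= rho(I) (a + 1) and j <= rho(J) (b + 1). As
    the symbolic powers of positive index lie in the ideal itself, a and b are
    positive when i and j are, and an elementary estimate (ratio_le_max) bounds
    (i + j) / r.

    Binomial expansion: write U_i and V_j for the symbolic powers of I and J. By
    the modular law, the sum of the U_i (x) V_j with i + j = m contains the
    intersection of the ideals U_i (x) B + A (x) V_j with i + j = m + 1. If f in
    the m-th symbolic power of I + J is nonzero in (A / U_i) (x) (B / V_j) for
    one of these pairs, then the ideal K = ((I + J)^m : f) kills a nonzero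
    element there. This property descends, one factor at a time, to
    (A / I) (x) (B / J) (kills_mod_symbolic_power), so K lies in an associated
    prime of I + J, which contradicts the choice of f. Elements of A (x) B modulo
    A (x) V are handled through finitely many coordinates in A, read off from
    normal forms with respect to the leading monomials of V (has_slices).

    Sharpness: the ideal generated by the squarefree monomials of degree 4 in 7
    variables has resurgence at least 2, because the product of the variables
    lies in its fourth symbolic power but not in its square. With the maximal
    ideal of k[y], of resurgence at most 1, the upper bound is the maximum of
    the two resurgences, hence is attained. *)

(** * Ideals, quotients and the maximal condition *)

Section Ideals.
Variable A : idomainType.
Implicit Types I J K P : set A.

Lemma is_ideal0 I : is_ideal I -> I 0. Proof. by case. Qed.

Lemma is_idealD I x y : is_ideal I -> I x -> I y -> I (x + y).
Proof. by case=> _ addI _; apply: addI. Qed.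

Lemma is_idealMl I a x : is_ideal I -> I x -> I (a * x).
Proof. by case=> _ _; apply. Qed.

Lemma is_idealMr I x a : is_ideal I -> I x -> I (x * a).
Proof. by rewrite mulrC; apply: is_idealMl. Qed.

Lemma is_idealB I x y : is_ideal I -> I x -> I y -> I (x - y).
Proof.
move=> hI Ix Iy; apply: is_idealD => //.
by rewrite -mulN1r; apply: is_idealMl.
Qed.

Lemma is_ideal_sum I (T : Type) (r : seq T) (F : T -> A) (P : pred T) :
  is_ideal I -> (forall i, P i -> I (F i)) -> I (\sum_(i <- r | P i) F i).
Proof.
move=> hI hF; apply: (big_ind I) => //; first exact: is_ideal0.
by move=> x y; apply: is_idealD.
Qed.

Lemma is_ideal_setT : is_ideal [set: A]. Proof. by []. Qed.

Lemma ideal_gen_ideal (S : set A) : is_ideal (ideal_gen S).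
Proof.
split=> [I [hI _]|x y Sx Sy I hSI|a x Sx I hSI].
- exact: is_ideal0.
- by apply: is_idealD; [case: hSI|apply: Sx|apply: Sy].
- by apply: is_idealMl; [case: hSI|apply: Sx].
Qed.

Lemma ideal_gen_min (S I : set A) : is_ideal I -> S `<=` I -> ideal_gen S `<=` I.
Proof. by move=> hI SI x; apply. Qed.

Lemma sub_ideal_gen (S : set A) : S `<=` ideal_gen S.
Proof. by move=> x Sx I [_]; apply. Qed.

Lemma ideal_mul_ideal I J : is_ideal (ideal_mul I J).
Proof. exact: ideal_gen_ideal. Qed.

Lemma mem_ideal_mul I J x y : I x -> J y -> ideal_mul I J (x * y).
Proof. by move=> Ix Jy; apply: sub_ideal_gen; exists x, y. Qed.

Lemma ideal_exp_ideal I n : is_ideal (ideal_exp I n).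
Proof. by case: n => [|n]; [exact: is_ideal_setT|exact: ideal_mul_ideal]. Qed.

Lemma ideal_mulS I n x : is_ideal I -> ideal_exp I n.+1 x -> ideal_exp I n x.
Proof.
move=> hI; apply: ideal_gen_min => [|z [u [v [_ v_In ->]]]].
  exact: ideal_exp_ideal.
by apply: is_idealMl => //; apply: ideal_exp_ideal.
Qed.

Lemma ideal_exp_le I m n : is_ideal I -> (m <= n)%N ->
  ideal_exp I n `<=` ideal_exp I m.
Proof.
move=> hI /subnKC <-; elim: (n - m)%N => [|d IHd] x; first by rewrite addn0.
by rewrite addnS => /(ideal_mulS hI) /IHd.
Qed.

Lemma ideal_exp1 I : is_ideal I -> ideal_exp I 1 = I.
Proof.
move=> hI; apply/seteqP; split=> x.
  by apply: ideal_gen_min => // z [u [v [Iu _ ->]]]; apply: is_idealMr.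
by move=> Ix; rewrite -[x]mulr1; apply: mem_ideal_mul.
Qed.

Lemma mem_ideal_expX I n x : I x -> ideal_exp I n (x ^+ n).
Proof.
by move=> Ix; elim: n => [//|n IHn]; rewrite exprS; apply: mem_ideal_mul.
Qed.

Lemma mem_ideal_expM I m n x y :
  ideal_exp I m x -> ideal_exp I n y -> ideal_exp I (m + n) (x * y).
Proof.
elim: m x => [|m IHm] x; first by move=> _ Iy; apply: is_idealMl Iy; apply: ideal_exp_ideal.
move=> Ix Iy; pose L := [set a | ideal_exp I (m.+1 + n) (a * y)].
have hL : is_ideal L.
  have hIe := ideal_exp_ideal I (m.+1 + n).
  split=> [|a b|a b]; rewrite /L /=.
  - by rewrite mul0r; apply: is_ideal0.
  - by rewrite mulrDl; apply: is_idealD.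
  - by rewrite -mulrA; apply: is_idealMl.
apply: (ideal_gen_min hL) Ix => _ [a [b [Ia Ib ->]]]; rewrite /L /= -mulrA.
by apply: mem_ideal_mul => //; apply: IHm.
Qed.

End Ideals.

Lemma is_ideal_preimage (A B : idomainType) (f : {rmorphism A -> B}) (I : set B) :
  is_ideal I -> is_ideal (f @^-1` I).
Proof.
move=> hI; split=> [|x y|a x] /=; first by rewrite rmorph0; apply: is_ideal0.
  by rewrite rmorphD; apply: is_idealD.
by rewrite rmorphM; apply: is_idealMl.
Qed.

Lemma ideal_exp_morph (A B : idomainType) (f : {rmorphism A -> B})
    (I : set A) (J : set B) n x :
  (forall a, I a -> J (f a)) -> ideal_exp I n x -> ideal_exp J n (f x).
Proof.
move=> fIJ; elim: n x => [//|n IHn] x.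
suff: ideal_exp I n.+1 `<=` f @^-1` ideal_exp J n.+1 by apply.
apply: ideal_gen_min.
  by apply: is_ideal_preimage; apply: ideal_exp_ideal.
move=> _ [a [b [Ia Ib ->]]]; rewrite /= rmorphM.
by apply: mem_ideal_mul; [apply: fIJ|apply: IHn].
Qed.

Section SymbolicPowers.
Variable A : idomainType.
Implicit Types I J K P : set A.

(** The colon ideal (I : x), that is, the annihilator of x modulo I. *)
Definition colon I (x : A) : set A := [set a | I (a * x)].

Lemma colon_ideal I x : is_ideal I -> is_ideal (colon I x).
Proof.
move=> hI; rewrite /colon; split=> [|a b|a b] /=.
- by rewrite mul0r; apply: is_ideal0.
- by rewrite mulrDl; apply: is_idealD.
- by rewrite -mulrA; apply: is_idealMl.
Qed.

Lemma prime_ideal P : is_prime_ideal P -> is_ideal P. Proof. by case. Qed.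

Lemma prime_neq0 P s : is_prime_ideal P -> ~ P s -> s != 0.
Proof. by move=> [hP _ _] nPs; apply/eqP=> s0; apply: nPs; rewrite s0; case: hP. Qed.

Lemma primeM P x y : is_prime_ideal P -> ~ P x -> ~ P y -> ~ P (x * y).
Proof. by case=> _ _ hP nPx nPy /hP[]. Qed.

Lemma prime_prod P (T : Type) (r : seq T) (F : T -> A) : is_prime_ideal P ->
  (forall i, ~ P (F i)) -> ~ P (\prod_(i <- r) F i).
Proof.
move=> pP nPF; apply: (big_ind (fun x => ~ P x)) => //; first by case: pP.
by move=> x y; apply: primeM.
Qed.

(** Membership in the contracted extension of an ideal, with denominators
    cleared. *)
Lemma contractionP P K a : is_prime_ideal P -> is_ideal K ->
  contraction P K a <-> exists2 s, ~ P s & K (s * a).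
Proof.
move=> pP hK; split; last first.
  move=> [s nPs Ksa]; exists 1%N, (fun=> tofrac 1 / tofrac s), (fun=> s * a).
  split=> // [_|]; first by exists 1, s.
  have s_neq0 := prime_neq0 pP nPs.
  rewrite big_ord1 rmorph1 mul1r rmorphM /= mulKf //.
  by rewrite tofrac_eq0.
move=> [l [u [b [hu hb ab]]]].
pose x j := sval (cid (hu j)); pose s j := sval (cid (svalP (cid (hu j)))).
have xsP j : ~ P (s j) /\ u j = tofrac (x j) / tofrac (s j).
  exact: (svalP (cid (svalP (cid (hu j))))).
have s_neq0 j : tofrac (s j) != 0.
  by rewrite tofrac_eq0; case: (xsP j) => /(prime_neq0 pP).
exists (\prod_j s j); first by apply: prime_prod => // j; case: (xsP j).
suff -> : (\prod_j s j) * a = \sum_j (\prod_(i | i != j) s i) * x j * b j.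
  by apply: is_ideal_sum => // j _; apply: is_idealMl.
apply/eqP; rewrite -tofrac_eq; apply/eqP.
rewrite rmorphM /= ab mulr_sumr rmorph_sum /=; apply: eq_bigr => j _.
rewrite [in LHS](bigD1 j) //= !rmorphM (xsP j).2 /=.
have simp (F : fieldType) (p q y z : F) : q != 0 ->
    q * p * (y / q * z) = p * y * z by move=> ?; field.
exact: simp.
Qed.

Lemma contraction_ideal P K : is_prime_ideal P -> is_ideal K ->
  is_ideal (contraction P K).
Proof.
move=> pP hK; split=> [|x y /contractionP hx /contractionP hy|a x /contractionP hx].
- by apply/contractionP => //; exists 1; [case: pP|rewrite mul1r; apply: is_ideal0].
- have [//|//|s nPs Ksx] := hx; have [//|//|t nPt Kty] := hy.
  apply/contractionP => //; exists (s * t); first exact: primeM.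
  have -> : s * t * (x + y) = t * (s * x) + s * (t * y) by ring.
  by apply: is_idealD => //; apply: is_idealMl.
- have [//|//|s nPs Ksx] := hx; apply/contractionP => //; exists s => //.
  by rewrite mulrCA; apply: is_idealMl.
Qed.

Lemma sub_contraction P K : is_prime_ideal P -> is_ideal K -> K `<=` contraction P K.
Proof.
move=> pP hK x Kx; apply/contractionP => //; exists 1; first by case: pP.
by rewrite mul1r.
Qed.

Lemma symbolic_power_ideal I n : is_ideal (symbolic_power I n).
Proof.
have hC P : associated_prime I P -> is_ideal (contraction P (ideal_exp I n)).
  by move=> [pP _]; apply: contraction_ideal => //; apply: ideal_exp_ideal.
split=> [P|x y hx hy P|a x hx P] PI.
- by apply: is_ideal0; apply: hC.
- by apply: is_idealD; [apply: hC|apply: hx|apply: hy].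
- by apply: is_idealMl; [apply: hC|apply: hx].
Qed.

Lemma symbolic_power_le I m n : is_ideal I -> (m <= n)%N ->
  symbolic_power I n `<=` symbolic_power I m.
Proof.
move=> hI mn x hx P PI; have [pP _] := PI.
have /contractionP[||s nPs hs] := hx P PI => //; first exact: ideal_exp_ideal.
apply/contractionP => //; first exact: ideal_exp_ideal.
by exists s => //; apply: ideal_exp_le hs.
Qed.

Lemma symbolic_power0 I : symbolic_power I 0 = setT.
Proof.
apply/seteqP; split=> // x _ P [pP _].
exact: (@sub_contraction P setT).
Qed.

Lemma ideal_exp_sub_symbolic I n : ideal_exp I n `<=` symbolic_power I n.
Proof.
by move=> x Ix P [pP _]; apply: sub_contraction => //; apply: ideal_exp_ideal.
Qed.

(** The noetherian hypothesis, in the form of the maximal condition. *)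
Definition noetherian := forall F : set (set A), F !=set0 ->
  (forall I, F I -> is_ideal I) ->
  exists2 I, F I & forall J, F J -> I `<=` J -> J `<=` I.

Hypothesis noethA : noetherian.

(** Some multiple c * f outside I has an annihilator modulo I that does not grow
    when passing to further multiples outside I. *)
Lemma exists_max_colon (I : set A) (f : A) : is_ideal I -> ~ I f ->
  exists2 c, ~ I (c * f) & forall x, ~ I (x * (c * f)) ->
    colon I (x * (c * f)) `<=` colon I (c * f).
Proof.
move=> hI nIf.
have [||_ [c nIcf ->] cmax] :=
    @noethA [set K | exists2 c, ~ I (c * f) & K = colon I (c * f)].
- by exists (colon I f); exists 1; rewrite mul1r.
- by move=> _ [c _ ->]; apply: colon_ideal.
exists c => // x nIxcf; apply: cmax.
  by exists (x * c); rewrite -mulrA.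
by move=> a; rewrite /colon /= => ?; rewrite mulrCA; apply: is_idealMl.
Qed.

(** Every proper annihilator modulo I lies in an associated prime of I. *)
Lemma exists_associated_prime I f : is_ideal I -> ~ I f ->
  exists2 P, associated_prime I P & colon I f `<=` P.
Proof.
move=> hI nIf; have [c nIcf cmax] := exists_max_colon hI nIf.
exists (colon I (c * f)); last first.
  by move=> a; rewrite /colon /= => ?; rewrite mulrCA; apply: is_idealMl.
split; last by exists (c * f).
split=> [||x y Ixy]; first exact: colon_ideal.
  by rewrite /colon /= mul1r.
case: (pselect (I (y * (c * f)))) => [|nIy]; first by right.
by left; apply: cmax nIy _ _; rewrite /colon /= mulrA.
Qed.

Lemma symbolic_power_sub I n : is_ideal I -> (0 < n)%N ->
  symbolic_power I n `<=` I.
Proof.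
move=> hI n_gt0 x Ix; apply: contrapT => nIx.
have [P PI Psub] := exists_associated_prime hI nIx; have [pP _] := PI.
have := symbolic_power_le hI n_gt0 Ix PI; rewrite ideal_exp1 //.
by move/contractionP => [//|//|s nPs Isx]; apply: nPs; apply: Psub.
Qed.

End SymbolicPowers.

(** * Irreducible ideals of a localization *)

Section Saturated.
Variable A : idomainType.
Implicit Types I J K P L : set A.
Hypothesis noethA : noetherian A.

(** The ideals of A that are contractions of ideals of the localization A_P. *)
Definition saturated P I := forall s x, ~ P s -> I (s * x) -> I x.

Lemma contraction_saturated P K : is_prime_ideal P -> is_ideal K ->
  saturated P (contraction P K).
Proof.
move=> pP hK s x nPs /contractionP[//|//|t nPt Ktsx].
apply/contractionP => //; exists (t * s); first exact: primeM.
by rewrite -mulrA.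
Qed.

(** If some power of every element of P is in D, then P kills a nonzero class
    modulo D. *)
Lemma exists_socle P D : is_ideal D -> ~ D 1 ->
  (forall x, P x -> exists t, D (x ^+ t)) ->
  exists2 c, ~ D c & forall x, P x -> D (x * c).
Proof.
move=> hD nD1 nilP; have [c] := exists_max_colon noethA hD nD1.
rewrite mulr1 => nDc cmax; exists c => // x Px; apply: contrapT => nDxc.
have [t Dxt] := nilP x Px.
suff: ~ D (x ^+ t * c) by apply; apply: is_idealMr.
elim: t {Dxt} => [|t IHt]; first by rewrite mul1r.
rewrite exprSr -mulrA => Dxtc; apply: IHt; exact: (cmax x).
Qed.

(** An ideal L maximal among the P-saturated ideals over U that avoid a: the
    class of a spans the socle of the local ring A_P / L A_P, which is
    one-dimensional, and the elements of P are nilpotent modulo L. *)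
Lemma exists_irreducible P U a : is_prime_ideal P -> is_ideal U ->
  saturated P U -> ~ U a ->
  exists L, [/\ [/\ is_ideal L, saturated P L & U `<=` L],
    ~ L a, forall x, P x -> L (x * a),
    forall x, P x -> exists t, L (x ^+ t)
    & forall z, (forall x, P x -> L (x * z)) ->
        exists r t, ~ P r /\ L (r * z - t * a)].
Proof.
move=> pP hU satU nUa; have hP := prime_ideal pP.
have [||L [hL UL satL nLa] Lmax] :=
    noethA (F := [set L | [/\ is_ideal L, U `<=` L, saturated P L & ~ L a]]).
- by exists U; split.
- by move=> L [].
have gen_a z : ~ L z -> exists s r, ~ P s /\ L (s * a - r * z).
  move=> nLz.
  pose M := [set y | exists s r, ~ P s /\ L (s * y - r * z)].
  have LM : L `<=` M.
    move=> y Ly; exists 1, 0; split; first by case: pP.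
    by rewrite mul1r mul0r subr0.
  apply: contrapT => nMa; apply: nLz; apply: (Lmax M) => //.
    split=> //; last 1 first.
    - move=> s x nPs [t [r [nPt Lr]]]; exists (t * s), r.
      by split; [exact: primeM|rewrite -mulrA].
    - split=> [|x y [s [r [nPs Lr]]] [s' [r' [nPs' Lr']]]|b x [s [r [nPs Lr]]]].
      + by apply: LM; apply: is_ideal0.
      + exists (s * s'), (s' * r + s * r'); split; first exact: primeM.
        have -> : s * s' * (x + y) - (s' * r + s * r') * z =
          s' * (s * x - r * z) + s * (s' * y - r' * z) by ring.
        by apply: is_idealD => //; apply: is_idealMl.
      + exists s, (b * r); split=> //.
        have -> : s * (b * x) - b * r * z = b * (s * x - r * z) by ring.
        exact: is_idealMl.
    - by move=> y /UL /LM.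
  exists 1, 1; split; first by case: pP.
  by rewrite subrr; apply: is_ideal0.
have Pa x : P x -> L (x * a).
  move=> Px; apply: contrapT => /gen_a[s [r [nPs Ls]]]; apply: nLa.
  apply: (satL (s - r * x)); last by rewrite mulrBl -mulrA.
  move=> Psrx; apply: nPs; rewrite -[s](subrK (r * x)).
  by apply: is_idealD => //; apply: is_idealMl.
exists L; split=> //.
  move=> x Px.
  have [||_ [t _ ->] tmax] :=
      noethA (F := [set K | exists2 t, True & K = colon L (x ^+ t)]).
  - by exists (colon L (x ^+ 0)); exists 0%N.
  - by move=> _ [t _ ->]; apply: colon_ideal.
  exists t; apply: contrapT => /gen_a[s [r [nPs Ls]]]; apply: nLa.
  apply: (satL s) => //; rewrite -[s * a](subrK (r * x ^+ t)).
  apply: is_idealD => //; apply: (tmax (colon L (x ^+ t.+1))).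
  - by exists t.+1.
  - by move=> y; rewrite /colon /= exprS mulrCA => ?; apply: is_idealMl.
  rewrite /colon /=.
  have -> : r * x ^+ t.+1 = s * (x * a) - x * (s * a - r * x ^+ t).
    by rewrite exprS; ring.
  by apply: is_idealB => //; apply: is_idealMl => //; apply: Pa.
move=> z Pz; case: (pselect (L z)) => [Lz|/gen_a[s [r [nPs Ls]]]].
  exists 1, 0; split; first by case: pP.
  by rewrite mul1r mul0r subr0.
exists r, s; split; last first.
  by rewrite -opprB -mulN1r; apply: is_idealMl.
move=> /Pz Lrz; apply: nLa; apply: (satL s) => //.
by rewrite -[s * a](subrK (r * z)); apply: is_idealD.
Qed.

End Saturated.

(** * Ideals of a tensor product *)

(** The additive span of the products of the elements of U with those of V. *)
Inductive tens (A B R : idomainType) (iA : A -> R) (iB : B -> R)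
    (U : set A) (V : set B) : R -> Prop :=
| tens_zero : tens iA iB U V 0
| tens_cons u v x :
    U u -> V v -> tens iA iB U V x -> tens iA iB U V (iA u * iB v + x).

Section Tensor.
Variables (A B R : idomainType).
Variables (iA : {rmorphism A -> R}) (iB : {rmorphism B -> R}).
Implicit Types (U : set A) (V : set B).
Local Notation tens := (tens iA iB).

Lemma mem_tens U V u v : U u -> V v -> tens U V (iA u * iB v).
Proof. by move=> Uu Vv; rewrite -[_ * _]addr0; apply: tens_cons => //; left. Qed.

Lemma tensD U V x y : tens U V x -> tens U V y -> tens U V (x + y).
Proof.
move=> hx hy; elim: hx => [|u v z Uu Vv _ IH]; first by rewrite add0r.
by rewrite -addrA; apply: tens_cons.
Qed.

Lemma tens_sum U V (T : Type) (r : seq T) (F : T -> R) :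
  (forall i, tens U V (F i)) -> tens U V (\sum_(i <- r) F i).
Proof.
move=> hF; apply: big_ind => //; [exact: tens_zero|].
by move=> x y; apply: tensD.
Qed.

Lemma tens_le U U' V V' : U `<=` U' -> V `<=` V' -> tens U V `<=` tens U' V'.
Proof.
move=> UU' VV' x; elim=> [|u v y Uu Vv _]; first by left.
by apply: tens_cons; [apply: UU'|apply: VV'].
Qed.

Lemma tens_sub (K : set R) U V : is_ideal K ->
  (forall u v, U u -> V v -> K (iA u * iB v)) -> tens U V `<=` K.
Proof.
move=> hK UVK x; elim=> [|u v y Uu Vv _]; first exact: is_ideal0.
by apply: is_idealD => //; apply: UVK.
Qed.

Hypothesis spanR : forall x : R, tens setT setT x.

Lemma tens_ideal U V : is_ideal U -> is_ideal V -> is_ideal (tens U V).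
Proof.
move=> hU hV; split=> [|x y|g x]; [by left|exact: tensD|].
elim: (spanR g) => [|a b h _ _ _ IH] hx; first by rewrite mul0r; left.
rewrite mulrDl; apply: tensD; last exact: IH.
elim: hx => [|u v y Uu Vv _ IHy]; first by rewrite mulr0; left.
rewrite mulrDr; apply: tensD => //; rewrite mulrACA -!rmorphM.
by apply: mem_tens; apply: is_idealMl.
Qed.

(** The ideal U (x) B + A (x) V of A (x) B, that is, the kernel of the map onto
    (A / U) (x) (B / V). *)
Definition qid U V : set R :=
  [set x | exists y z, [/\ tens U setT y, tens setT V z & x = y + z]].

Lemma tens_qidl U V : tens U setT `<=` qid U V.
Proof. by move=> x Ux; exists x, 0; rewrite addr0; split=> //; left. Qed.

Lemma tens_qidr U V : tens setT V `<=` qid U V.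
Proof. by move=> x Ux; exists 0, x; rewrite add0r; split=> //; left. Qed.

Lemma qid_ideal U V : is_ideal U -> is_ideal V -> is_ideal (qid U V).
Proof.
move=> hU hV; have hUT := tens_ideal hU (is_ideal_setT B).
have hTV := tens_ideal (is_ideal_setT A) hV.
split=> [|x y|g x].
- by apply: tens_qidl; left.
- move=> [x1 [x2 [Ux1 Vx2 ->]]] [y1 [y2 [Uy1 Vy2 ->]]].
  by exists (x1 + y1), (x2 + y2); rewrite addrACA; split=> //; apply: tensD.
- move=> [x1 [x2 [Ux1 Vx2 ->]]]; exists (g * x1), (g * x2).
  by rewrite mulrDr; split=> //; apply: is_idealMl.
Qed.

Lemma qid_le U U' V : U `<=` U' -> qid U V `<=` qid U' V.
Proof.
by move=> UU' _ [y [z [Uy Vz ->]]]; exists y, z; split=> //; apply: tens_le Uy.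
Qed.

Lemma qid_tensl U V x u : is_ideal U -> U u -> qid U V (iA u * x).
Proof.
move=> hU Uu; apply: tens_qidl; have hUT := tens_ideal hU (is_ideal_setT B).
apply: is_idealMr => //; rewrite -[iA u]mulr1 -(rmorph1 iB).
exact: mem_tens.
Qed.

(** Coordinates of the elements of A (x) B modulo A (x) V, in a basis of a
    complement of V in B with members y b: the coordinate maps c b are A-linear
    and detect membership in U (x) B + A (x) V for every ideal U of A. *)
Definition has_slices V := exists (X : Type) (c : X -> R -> A) (y : X -> B),
  [/\ forall b f g, c b (f + g) = c b f + c b g,
      forall b a f, c b (iA a * f) = a * c b f,
      forall U f, is_ideal U -> qid U V f -> forall b, U (c b f)
    & forall U f, is_ideal U -> tens U setT f ->
        exists s : seq X, tens U V (f - \sum_(b <- s) iA (c b f) * iB (y b))].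

Section Slices.
Variables (V : set B) (X : Type) (c : X -> R -> A) (y : X -> B).
Hypothesis hV : is_ideal V.
Hypothesis c_tens : forall U f, is_ideal U -> tens U setT f ->
  exists s : seq X, tens U V (f - \sum_(b <- s) iA (c b f) * iB (y b)).

Lemma slices_qid U f : is_ideal U -> (forall b, U (c b f)) -> qid U V f.
Proof.
move=> hU Uf; have [s hs] := c_tens (is_ideal_setT A) (spanR f).
rewrite -(subrK (\sum_(b <- s) iA (c b f) * iB (y b)) f).
apply: is_idealD; [exact: qid_ideal|exact: tens_qidr|].
by apply: tens_qidl; apply: tens_sum => b; apply: mem_tens.
Qed.

End Slices.

(** The modular law: (U / U') (x) (B / V) embeds into (A / U') (x) (B / V). *)
Lemma qid_modular U U' V f : has_slices V ->
  is_ideal U -> is_ideal U' -> tens U setT f -> qid U' V f ->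
  exists f1 f2, [/\ tens U' setT f1, tens U V f2 & f = f1 + f2].
Proof.
move=> [X [c [y [_ _ c_qid c_tens]]]] hU hU' Uf qf.
have [s hs] := c_tens U f hU Uf.
exists (\sum_(b <- s) iA (c b f) * iB (y b)).
exists (f - \sum_(b <- s) iA (c b f) * iB (y b)); split=> //.
  by apply: tens_sum => b; apply: mem_tens => //; apply: c_qid qf _.
by rewrite addrC subrK.
Qed.

(** Key step: a set K of elements of A (x) B that kills a nonzero element of
    (A / I^(i)) (x) (B / V) also kills a nonzero element of (A / I) (x) (B / V).
    The first element stays nonzero in (A / L) (x) (B / V) for an irreducible
    ideal L of a localization A_P, with P associated to I; a multiple of it by
    an element of A has coordinates in the socle of A_P / L A_P, hence comes, up
    to a factor outside P, from an element of (A / P) (x) (B / V), and A / P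
    embeds into A / I. *)
Lemma kills_mod_symbolic_power (noethA : noetherian A) (I : set A) (V : set B)
    (i : nat) (K : set R) (f : R) :
  is_ideal I -> is_ideal V -> has_slices V ->
  ~ qid (symbolic_power I i) V f ->
  (forall g, K g -> qid (symbolic_power I i) V (g * f)) ->
  exists2 z, ~ qid I V z & forall g, K g -> qid I V (g * z).
Proof.
move=> hI hV [X [c [y [cD cM c_qid c_tens]]]] nqf Kf.
have sqid := @slices_qid V X c y hV c_tens.
have [b0 nSb0] : exists b, ~ symbolic_power I i (c b f).
  apply: contrapT => h; apply: nqf; apply: (sqid) => [|b].
    exact: symbolic_power_ideal.
  by apply: contrapT => nS; apply: h; exists b.
have [P PI nPb0] : exists2 P, associated_prime I P &
    ~ contraction P (ideal_exp I i) (c b0 f).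
  apply: contrapT => h; apply: nSb0 => P PI; apply: contrapT => nP.
  by apply: h; exists P.
have [pP [c0 defP]] := PI; have hIi := ideal_exp_ideal I i.
have [L [[hL satL UL] nLa LPa Lnil Lsoc]] := exists_irreducible noethA pP
  (contraction_ideal pP hIi) (contraction_saturated pP hIi) nPb0.
move: (c b0 f) nLa LPa Lsoc (fun q => c_qid L f hL q b0) => a nLa LPa Lsoc nqLf.
have {}UL : symbolic_power I i `<=` L by move=> x Sx; apply/UL/Sx.
have hq := qid_ideal hL hV.
(* the multiple of f with coordinates in the socle *)
pose D := [set x | qid L V (iA x * f)].
have hD : is_ideal D.
  split=> [|x x'|x x']; rewrite /D /=.
  - by rewrite rmorph0 mul0r; apply: is_ideal0.
  - by rewrite rmorphD mulrDl; apply: is_idealD.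
  - by rewrite rmorphM -mulrA; apply: is_idealMl.
have nD1 : ~ D 1 by rewrite /D /= rmorph1 mul1r => /nqLf.
have [x /Lnil[t Lxt]|d nDd PDd] := exists_socle (P := P) noethA hD nD1.
  by exists t; apply: qid_tensl.
pose z := iA d * f; have Pz b x : P x -> L (x * c b z).
  by move=> /PDd; rewrite /D /= rmorphM -mulrA -cM => /(c_qid L _ hL); apply.
have [s hs] := c_tens setT z (is_ideal_setT A) (spanR z).
have [r [tau [nPr qtau]]] : exists r tau, ~ P r /\
    qid L V (iA r * (\sum_(b <- s) iA (c b z) * iB (y b)) - iA a * tau).
  elim: (s) => [|b s' [r [tau [nPr IH]]]].
    exists 1, 0; split; first by case: pP.
    by rewrite big_nil !mulr0 subr0; apply: is_ideal0.
  have [rb [tb [nPrb Lb]]] := Lsoc _ (Pz b).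
  exists (rb * r), (iA (r * tb) * iB (y b) + iA rb * tau).
  split; first exact: primeM.
  have -> : iA (rb * r) * (\sum_(b <- b :: s') iA (c b z) * iB (y b)) -
    iA a * (iA (r * tb) * iB (y b) + iA rb * tau) =
    iA (rb * c b z - tb * a) * (iA r * iB (y b)) +
    iA rb * (iA r * (\sum_(b <- s') iA (c b z) * iB (y b)) - iA a * tau).
    by rewrite big_cons !rmorphB !rmorphM /=; ring.
  by apply: is_idealD => //; [apply: qid_tensl|apply: is_idealMl].
have {hs}qtau : qid L V (iA r * z - iA a * tau).
  have -> : iA r * z - iA a * tau =
    iA r * (z - \sum_(b <- s) iA (c b z) * iB (y b)) +
    (iA r * (\sum_(b <- s) iA (c b z) * iB (y b)) - iA a * tau) by ring.
  apply: is_idealD => //; apply: is_idealMl => //; exact: tens_qidr.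
exists (iA c0 * tau).
  move=> qI; apply: nDd; rewrite /D /=; apply: (sqid) => // b.
  apply: (satL r) => //; rewrite -cM; apply: (c_qid) => //.
  rewrite -[iA r * _](subrK (iA a * tau)); apply: is_idealD => //.
  apply: (sqid) => // b'; rewrite cM mulrC; apply: LPa.
  by rewrite defP /= mulrC -cM; apply: (c_qid) qI _.
move=> g /Kf qgf; apply: (sqid) => // b.
rewrite mulrCA cM mulrC; suff: P (c b (g * tau)) by rewrite defP.
apply: contrapT => /satL satLb; apply/nLa/satLb.
rewrite mulrC -cM; apply: (c_qid) => //.
have -> : iA a * (g * tau) =
  (iA r * iA d) * (g * f) - g * (iA r * z - iA a * tau) by rewrite /z; ring.
apply: is_idealB => //; apply: is_idealMl => //.
exact: (qid_le UL).
Qed.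

(** The associated primes of U (x) B + A (x) V contract to associated primes
    of U. *)
Lemma associated_prime_preimage U V Q : is_ideal U -> is_ideal V ->
  has_slices V -> associated_prime (qid U V) Q -> associated_prime U (iA @^-1` Q).
Proof.
move=> hU hV [X [c [y [cD cM c_qid c_tens]]]] [pQ [x defQ]].
have pP : is_prime_ideal (iA @^-1` Q).
  split; [exact: is_ideal_preimage (prime_ideal pQ)| |].
    by rewrite /preimage /= rmorph1; case: pQ.
  by move=> u v; rewrite /preimage /= rmorphM; case: pQ => _ _; apply.
split=> //; have [s hs] := c_tens setT x (is_ideal_setT A) (spanR x).
have Qcolon b a : (iA @^-1` Q) a -> U (a * c b x).
  by rewrite /preimage /= defQ /= -cM => ?; apply: (c_qid).
suff [b hb] : exists b, colon U (c b x) `<=` iA @^-1` Q.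
  by exists (c b x); apply/seteqP; split=> // a; apply: Qcolon.
apply: contrapT => nb.
(* otherwise a product of elements outside Q would kill x *)
have [r nQr Ur] : exists2 r, ~ (iA @^-1` Q) r &
    tens U setT (iA r * (\sum_(b <- s) iA (c b x) * iB (y b))).
  elim: (s) => [|b s' [r nQr IH]].
    by exists 1; [case: pP|rewrite big_nil mulr0; left].
  have [rb Urb nQrb] : exists2 rb, colon U (c b x) rb & ~ (iA @^-1` Q) rb.
    apply: contrapT => h; apply: nb; exists b => a Ua; apply: contrapT => nQa.
    by apply: h; exists a.
  exists (rb * r); first exact: primeM.
  have hUT := tens_ideal hU (is_ideal_setT B).
  rewrite big_cons mulrDr; apply: is_idealD => //; last first.
    by rewrite rmorphM -mulrA; apply: is_idealMl.
  rewrite mulrA -rmorphM mulrAC; apply: mem_tens => //.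
  by apply: is_idealMr.
apply: nQr; rewrite /preimage /= defQ /=.
rewrite -[x](subrK (\sum_(b <- s) iA (c b x) * iB (y b))) mulrDr.
apply: is_idealD; [exact: qid_ideal| |exact: tens_qidl].
by apply: is_idealMl; [exact: qid_ideal|exact: tens_qidr].
Qed.

End Tensor.

(** * Symbolic powers of a sum of ideals *)

Lemma tens_swap (A B R : idomainType) (iA : {rmorphism A -> R})
    (iB : {rmorphism B -> R}) (U : set A) (V : set B) x :
  tens iA iB U V x -> tens iB iA V U x.
Proof.
elim=> [|u v y Uu Vv _]; first by left.
by rewrite mulrC; apply: tens_cons.
Qed.

Lemma qid_swap (A B R : idomainType) (iA : {rmorphism A -> R})
    (iB : {rmorphism B -> R}) (U : set A) (V : set B) :
  qid iA iB U V = qid iB iA V U.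
Proof.
apply/seteqP; split=> _ [y [z [/tens_swap hy /tens_swap hz ->]]];
by exists z, y; rewrite addrC.
Qed.

Lemma tensM (A B R : idomainType) (iA : {rmorphism A -> R})
    (iB : {rmorphism B -> R}) (U U' U2 : set A) (V V' V2 : set B) x y :
  (forall u u', U u -> U' u' -> U2 (u * u')) ->
  (forall v v', V v -> V' v' -> V2 (v * v')) ->
  tens iA iB U V x -> tens iA iB U' V' y -> tens iA iB U2 V2 (x * y).
Proof.
move=> hU hV; elim=> [|u v z Uu Vv _ IH] hy; first by rewrite mul0r; left.
rewrite mulrDl; apply: tensD; last exact: IH.
elim: hy => [|u' v' w Uu' Vv' _ IHw]; first by rewrite mulr0; left.
rewrite mulrDr; apply: tensD => //; rewrite mulrACA -!rmorphM.
by apply: mem_tens; [apply: hU|apply: hV].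
Qed.

Section SumOfIdeals.
Variables (A B R : idomainType).
Variables (iA : {rmorphism A -> R}) (iB : {rmorphism B -> R}).
Hypothesis spanR : forall x : R, tens iA iB setT setT x.
Hypothesis slicesB : forall V, is_ideal V -> has_slices iA iB V.
Variables (I : set A) (J : set B).
Hypotheses (hI : is_ideal I) (hJ : is_ideal J).
Local Notation S := (qid iA iB I J).

Lemma qid_exp_sub m i j : (i + j <= m.+1)%N ->
  ideal_exp S m `<=` qid iA iB (ideal_exp I i) (ideal_exp J j).
Proof.
have qid0 i' j' x : (i' == 0)%N || (j' == 0)%N ->
    qid iA iB (ideal_exp I i') (ideal_exp J j') x.
  by case/orP=> /eqP->; [apply: tens_qidl|apply: tens_qidr]; apply: spanR.
elim: m i j => [|m IHm] [|i] [|j] ij; try by move=> x _; apply: qid0.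
  by move: ij; rewrite addnS addSn.
have hq := qid_ideal spanR (ideal_exp_ideal I i.+1) (ideal_exp_ideal J j.+1).
apply: ideal_gen_min => // _ [_ [y [[u [v [Iu Jv ->]]] Sy ->]]].
rewrite mulrDl; apply: is_idealD => //.
  have [|y1 [y2 [hy1 hy2 ->]]] := IHm i j.+1 _ y Sy; first by lia.
  rewrite mulrDr; apply: is_idealD => //.
    apply: tens_qidl; apply: tensM Iu hy1 => // a b Ia Ib.
    exact: mem_ideal_mul.
  by apply: is_idealMl => //; apply: tens_qidr.
have [|y1 [y2 [hy1 hy2 ->]]] := IHm i.+1 j _ y Sy; first by lia.
rewrite mulrDr; apply: is_idealD => //.
  by apply: is_idealMl => //; apply: tens_qidl.
apply: tens_qidr; apply: tensM Jv hy2 => // a b Ja Jb.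
exact: mem_ideal_mul.
Qed.

Lemma mem_qid_exp i j u v : ideal_exp I i u -> ideal_exp J j v ->
  ideal_exp S (i + j) (iA u * iB v).
Proof.
move=> Iu Jv; apply: mem_ideal_expM.
  apply: ideal_exp_morph Iu => a Ia; rewrite -[iA a]mulr1 -(rmorph1 iB).
  by apply: tens_qidl; apply: mem_tens.
apply: ideal_exp_morph Jv => b Jb; rewrite -[iB b]mul1r -(rmorph1 iA).
by apply: tens_qidr; apply: mem_tens.
Qed.

Lemma symbolic_power_inl m u :
  symbolic_power I m u -> symbolic_power S m (iA u).
Proof.
move=> Iu Q QS; have [pQ _] := QS.
have PI := associated_prime_preimage spanR hI hJ (slicesB hJ) QS.
have [pP _] := PI; have /contractionP[||s nPs Is] := Iu _ PI => //.
  exact: ideal_exp_ideal.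
apply/contractionP => //; first exact: ideal_exp_ideal.
exists (iA s) => //; rewrite -rmorphM -[iA _]mulr1 -(rmorph1 iB).
by rewrite -[m]addn0; apply: mem_qid_exp.
Qed.

Lemma ideal_exp_inl (rA : {rmorphism R -> A}) r u : cancel iA rA ->
  (forall b, J b -> rA (iB b) = 0) -> ideal_exp S r (iA u) -> ideal_exp I r u.
Proof.
move=> iAK rJ; rewrite -{2}(iAK u); apply: ideal_exp_morph => w.
move=> [y [z [Iy Jz ->]]]; rewrite rmorphD.
apply: is_idealD => //.
  elim: Iy => [|a b x Ia Tb Tx IH]; first by rewrite rmorph0; apply: is_ideal0.
  rewrite rmorphD rmorphM; apply: is_idealD => //.
  by apply: is_idealMr => //; rewrite iAK.
elim: Jz => [|a b x Ta Jb Tx IH]; first by rewrite rmorph0; apply: is_ideal0.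
by rewrite rmorphD rmorphM /= (rJ b Jb) mulr0 add0r.
Qed.

Hypothesis slicesA : forall U, is_ideal U -> has_slices iB iA U.
Hypotheses (noethA : noetherian A) (noethB : noetherian B).
Hypothesis noethR : noetherian R.

Lemma symbolic_power_sub_qid m i j : (i + j <= m.+1)%N ->
  symbolic_power S m `<=` qid iA iB (symbolic_power I i) (symbolic_power J j).
Proof.
move=> ij f Sf; apply: contrapT => nqf.
have spanR' x : tens iB iA setT setT x by apply: tens_swap.
have hIi := symbolic_power_ideal I i; have hJj := symbolic_power_ideal J j.
pose K := [set g | ideal_exp S m (g * f)].
have [|z nqz Kz] := kills_mod_symbolic_power (K := K) spanR noethA hI hJj
  (slicesB hJj) nqf.
  move=> g /(qid_exp_sub ij) [y [z [hy hz ->]]]; exists y, z; split=> //.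
    exact: (tens_le (@ideal_exp_sub_symbolic _ I i) _ hy).
  exact: (tens_le _ (@ideal_exp_sub_symbolic _ J j) hz).
rewrite qid_swap in nqz; have [|w nqw Kw] := kills_mod_symbolic_power (K := K)
  spanR' noethB hJ hI (slicesA hI) nqz.
  by move=> g /Kz; rewrite qid_swap.
rewrite -qid_swap in nqw; have hS := qid_ideal spanR hI hJ.
have [Q QS Qw] := exists_associated_prime noethR hS nqw.
have [pQ _] := QS; have /contractionP[||s nQs Ss] := Sf _ QS => //.
  exact: ideal_exp_ideal.
by apply: nQs; apply: Qw; rewrite /colon /= qid_swap; apply: Kw.
Qed.

(** One inclusion of the binomial expansion of symbolic powers: the m-th
    symbolic power of the sum lies in every ideal that contains the products
    of the i-th symbolic power of I and the j-th one of J, for i + j = m. *)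
Lemma symbolic_power_sum_sub m (G : set R) : is_ideal G ->
  (forall i j u v, (i + j)%N = m -> symbolic_power I i u ->
    symbolic_power J j v -> G (iA u * iB v)) ->
  symbolic_power S m `<=` G.
Proof.
move=> hG IJG f Sf.
pose q i j := qid iA iB (symbolic_power I i) (symbolic_power J j).
have hq i j : is_ideal (q i j).
  by apply: qid_ideal => //; apply: symbolic_power_ideal.
have tensG i j : (i + j)%N = m ->
    tens iA iB (symbolic_power I i) (symbolic_power J j) `<=` G.
  by move=> ij; apply: tens_sub => // u v; apply: IJG.
(* modulo G, the element f can be pushed down the filtration by the ideals
   generated by the symbolic powers of I *)
suff /(_ m (leqnn m)) [g [Ig Gfg _]] : forall i, (i <= m)%N -> exists g,
    [/\ tens iA iB (symbolic_power I i) setT g, G (f - g)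
      & forall i' j', (i' + j' <= m.+1)%N -> q i' j' g].
  rewrite -[f](subrK g); apply: is_idealD => //; apply: (tensG m 0%N).
    by rewrite addn0.
  by rewrite symbolic_power0.
elim=> [_|i IHi im].
  exists f; rewrite symbolic_power0 subrr; split; [exact: spanR| |].
    exact: is_ideal0.
  by move=> i' j' ij; apply: (symbolic_power_sub_qid ij).
have [g [Ig Gfg qg]] := IHi (ltnW im).
have [|g1 [g2 [Ig1 IJg2 def_g]]] := qid_modular
  (slicesB (symbolic_power_ideal J (m - i))) (symbolic_power_ideal I i)
  (symbolic_power_ideal I i.+1) Ig.
  by apply: qg; lia.
exists g1; split=> //.
  have -> : f - g1 = (f - g) + g2 by rewrite def_g; ring.
  by apply: is_idealD => //; apply: tensG IJg2; lia.
move=> i' j' ij; have -> : g1 = g - g2 by rewrite def_g; ring.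
apply: is_idealB => //; first exact: qg.
case: (leqP i' i) => i'i.
  apply: tens_qidl; apply: tens_le IJg2 => //.
  exact: symbolic_power_le.
apply: tens_qidr; apply: tens_le IJg2 => //.
by apply: symbolic_power_le => //; lia.
Qed.

End SumOfIdeals.

(** * Polynomial rings are noetherian *)

Section Dickson.

Lemma nondecreasing_subsequence (v : nat -> nat) : exists sigma : nat -> nat,
  (forall s, (sigma s < sigma s.+1)%N) /\
  (forall s t, (s <= t)%N -> (v (sigma s) <= v (sigma t))%N).
Proof.
have /choice[g gP] : forall N, exists i,
    (N <= i)%N /\ forall j, (N <= j)%N -> (v i <= v j)%N.
  move=> N.
  have ex_val : exists x, `[< exists2 i, (N <= i)%N & v i = x >].
    by exists (v N); apply/asboolP; exists N.
  case: (ex_minnP ex_val) => _ /asboolP[i Ni <-] vmin.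
  by exists i; split=> // j Nj; apply: vmin; apply/asboolP; exists j.
pose sigma s := iter s (fun x => g x.+1) (g 0%N).
have sigmaS s : (sigma s < sigma s.+1)%N by case: (gP (sigma s).+1).
exists sigma; split=> // s t /subnKC <-; elim: (t - s)%N => [|d IHd].
  by rewrite addn0.
apply: leq_trans IHd _; rewrite addnS; case: (s + d)%N => [|e].
  by case: (gP 0%N) => _; apply.
by case: (gP (sigma e).+1) => _; apply; apply: ltn_trans (sigmaS e) (sigmaS e.+1).
Qed.

(** Dickson's lemma. *)
Lemma dickson n (u : nat -> 'X_{1..n}) :
  exists i j, (i < j)%N /\ (u i <= u j)%MM.
Proof.
suff /(_ n (leqnn n)) [sigma [sigmaS usigma]] : forall c, (c <= n)%N ->
    exists sigma : nat -> nat,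
    (forall s, (sigma s < sigma s.+1)%N) /\ forall (i : 'I_n), (i < c)%N ->
    forall s t, (s <= t)%N -> (u (sigma s) i <= u (sigma t) i)%N.
  exists (sigma 0%N), (sigma 1%N); split=> //.
  by apply/mnm_lepP => i; apply: usigma.
elim=> [_|c IHc cn]; first by exists id.
have [sigma [sigmaS usigma]] := IHc (ltnW cn).
have [tau [tauS utau]] :=
  nondecreasing_subsequence (fun s => u (sigma s) (Ordinal cn)).
have mono (f : nat -> nat) : (forall s, (f s < f s.+1)%N) ->
    forall s t, (s < t)%N -> (f s < f t)%N.
  move=> fS s t /subnKC <-; elim: (t - s.+1)%N => [|d IHd]; first by rewrite addn0.
  by rewrite addnS; apply: ltn_trans IHd (fS _).
exists (sigma \o tau); split=> [s|i]; first exact: (mono sigma).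
rewrite ltnS leq_eqVlt => /orP[/eqP ic|ic] s t st.
  by have -> : i = Ordinal cn by [apply: val_inj]; apply: utau.
apply: usigma => //; move: st; rewrite leq_eqVlt => /orP[/eqP->//|st].
by apply/ltnW/(mono tau).
Qed.

End Dickson.

Section LeadingMonomials.
Variables (k : fieldType) (n : nat).
Implicit Types p q r : {mpoly k[n]}.

Lemma mlead_reduce p q : p != 0 -> (mlead p <= mlead q)%MM ->
  exists a, q - a * p = 0 \/ (mlead (q - a * p) < mlead q)%O.
Proof.
move=> p0 pq; have lc_p : p@_(mlead p) != 0 by rewrite mleadc_eq0.
set m := (mlead q - mlead p)%MM.
pose c := q@_(mlead q) / p@_(mlead p); exists (c *: 'X_[m]).
rewrite -scalerAl mulrC; set r := q - _.
have [->|r0] := eqVneq r 0; [by left|right].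
have rq : r@_(mlead q) = 0.
  rewrite mcoeffB mcoeffZ -{2}(submK pq) -/m mcoeffMX mulfVK ?subrr //.
have le_rq : (mlead r <= mlead q)%O.
  apply: le_trans (mleadB_le _ _) _; rewrite leUx lexx /=.
  apply: le_trans (mleadZ_le _ _) _; apply: le_trans (mleadM_le _ _) _.
  by rewrite mleadXm addmC submK.
rewrite lt_neqAle le_rq andbT; apply: contraNneq r0 => e.
by rewrite -mleadc_eq0 e rq.
Qed.

Lemma exists_min_mlead (D : set {mpoly k[n]}) : D !=set0 ->
  exists2 p, D p & forall q, D q -> ~ (mlead q < mlead p)%O.
Proof.
case=> p0; elim/mleadrect: p0 => p IH Dp.
have [[q [Dq lt_qp]]|h] := pselect (exists q, D q /\ (mlead q < mlead p)%O).
  exact: (IH q).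
by exists p => // q Dq lt_qp; apply: h; exists q.
Qed.

(** Hilbert's basis theorem: along a strictly increasing sequence of ideals,
    new elements with minimal leading monomials would contradict Dickson's
    lemma. *)
Lemma mpoly_noetherian : noetherian {mpoly k[n]}.
Proof.
move=> F [I0 FI0] idF; apply: contrapT => nomax.
have /choice[next nextP] : forall I : {I | F I}, exists J : {J | F J},
    sval I `<=` sval J /\ exists2 x, sval J x & ~ sval I x.
  move=> [I FI] /=; apply: contrapT => h; apply: nomax; exists I => // J FJ IJ x Jx.
  by apply: contrapT => nIx; apply: h; exists (exist _ J FJ); split=> //; exists x.
pose Is s := iter s next (exist _ I0 FI0).
have hIs s : is_ideal (sval (Is s)) by apply: idF; apply: (svalP (Is s)).
have Is_le s t : (s <= t)%N -> sval (Is s) `<=` sval (Is t).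
  move/subnKC <-; elim: (t - s)%N => [|d IHd]; first by rewrite addn0.
  by rewrite addnS => x /IHd; apply: (nextP (Is (s + d)%N)).1.
have /choice[x xP] : forall s, exists x,
    [/\ sval (Is s.+1) x, ~ sval (Is s) x & forall y, sval (Is s.+1) y ->
      ~ sval (Is s) y -> ~ (mlead y < mlead x)%O].
  move=> s; have [x Jx nIx] := (nextP (Is s)).2.
  have [|y [Jy nIy] ymin] :=
    @exists_min_mlead (sval (Is s.+1) `\` sval (Is s)); first by exists x.
  by exists y; split=> // z Jz nIz; apply: ymin.
have [i [j [ij xij]]] := dickson (fun s => mlead (x s)).
have [xi nxi _] := xP i; have [xj nxj xjmin] := xP j.
have xi_neq0 : x i != 0.
  by apply/eqP => x0; apply: nxi; rewrite x0; apply: is_ideal0.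
have [a ha] := mlead_reduce xi_neq0 xij.
have Ixi : sval (Is j) (a * x i) by apply: is_idealMl => //; apply: Is_le ij _ xi.
have nIr : ~ sval (Is j) (x j - a * x i).
  by move=> h; apply: nxj; rewrite -[x j](subrK (a * x i)); apply: is_idealD.
case: ha => [r0|]; first by apply: nIr; rewrite r0; apply: is_ideal0.
apply: xjmin => //; apply: is_idealB => //.
by apply: (Is_le j j.+1) => //.
Qed.

(** * Normal forms modulo an ideal *)

Variable V : set {mpoly k[n]}.
Hypothesis hV : is_ideal V.

(** Polynomials none of whose monomials leads an element of V: a complement
    of V. *)
Definition reduced r := forall m, r@_m != 0 ->
  ~ exists v, [/\ V v, v != 0 & mlead v = m].

Lemma reduced_eq0 r : V r -> reduced r -> r = 0.
Proof.
move=> Vr red_r; apply/eqP; apply: contrapT => /negP r0.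
by apply: (red_r (mlead r)); [rewrite mleadc_eq0|exists r].
Qed.

Lemma reduced0 : reduced 0.
Proof. by move=> m; rewrite mcoeff0 eqxx. Qed.

Lemma reducedD p q : reduced p -> reduced q -> reduced (p + q).
Proof.
move=> rp rq m; rewrite mcoeffD; have [->|pm _] := eqVneq p@_m 0.
  by rewrite add0r; apply: rq.
exact: rp.
Qed.

Lemma reducedZ c p : reduced p -> reduced (c *: p).
Proof.
move=> rp m; rewrite mcoeffZ mulf_eq0 negb_or => /andP[_].
exact: rp.
Qed.

Lemma reduced_exists p : exists2 r, V (p - r) & reduced r.
Proof.
elim/mleadrect: p => p IH; have [->|p0] := eqVneq p 0.
  by exists 0; [rewrite subrr; apply: is_ideal0|exact: reduced0].
have [[v [Vv v0 vp]]|nlead] :=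
    pselect (exists v, [/\ V v, v != 0 & mlead v = mlead p]).
  have [|a ha] := @mlead_reduce v p v0; first by rewrite vp; apply: lepm_refl.
  have [r Vr red_r] : exists2 r, V (p - a * v - r) & reduced r.
    case: ha => [->|]; last exact: IH.
    by exists 0; [rewrite subr0; apply: is_ideal0|exact: reduced0].
  exists r => //; have -> : p - r = (p - a * v - r) + a * v by ring.
  by apply: is_idealD => //; apply: is_idealMl.
set t := p@_(mlead p) *: 'X_[mlead p].
have red_t : reduced t.
  apply: reducedZ => m; rewrite mcoeffX.
  by have [<- _|_] := eqVneq (mlead p) m; last by rewrite eqxx.
have [q0|q0] := eqVneq (p - t) 0.
  by exists t => //; rewrite q0; apply: is_ideal0.
have [r Vr red_r] := IH _ (ltm_mleadD p0 q0).
exists (r + t); last exact: reducedD.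
by have -> : p - (r + t) = p - t - r by ring.
Qed.

(** The normal form of p modulo V; this projection is linear with kernel V. *)
Definition normal_form p : {mpoly k[n]} := s2val (cid2 (reduced_exists p)).

Lemma normal_formP p : V (p - normal_form p) /\ reduced (normal_form p).
Proof. by rewrite /normal_form; case: cid2. Qed.

Lemma normal_form_unique p r : V (p - r) -> reduced r -> normal_form p = r.
Proof.
move=> Vr red_r; have [Vp red_p] := normal_formP p; apply/eqP.
rewrite -subr_eq0; apply/eqP; apply: reduced_eq0.
  have -> : normal_form p - r = (p - r) - (p - normal_form p) by ring.
  exact: is_idealB.
by apply: reducedD => //; rewrite -scaleN1r; apply: reducedZ.
Qed.

Lemma normal_formD p q : normal_form (p + q) = normal_form p + normal_form q.
Proof.
have [Vp red_p] := normal_formP p; have [Vq red_q] := normal_formP q.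
apply: normal_form_unique; last exact: reducedD.
by rewrite opprD addrACA; apply: is_idealD.
Qed.

Lemma normal_formZ c p : normal_form (c *: p) = c *: normal_form p.
Proof.
have [Vp red_p] := normal_formP p.
apply: normal_form_unique; last exact: reducedZ.
by rewrite -scalerBr -mul_mpolyC; apply: is_idealMl.
Qed.

Lemma normal_form_eq0 v : V v -> normal_form v = 0.
Proof.
by move=> Vv; apply: normal_form_unique; [rewrite subr0|exact: reduced0].
Qed.

End LeadingMonomials.

(** * The tensor product of two polynomial rings *)

Section LinearExtension.
Variables (k : fieldType) (N : nat) (M : lmodType k) (h : 'X_{1..N} -> M).

(** The linear map that takes the monomial m to h m. *)
Definition lin_ext (f : {mpoly k[N]}) : M := \sum_(m <- msupp f) f@_m *: h m.

Lemma lin_ext_bounded d f : (msize f <= d)%N ->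
  lin_ext f = \sum_(m : 'X_{1..N < d}) f@_m *: h m.
Proof.
move=> fd; rewrite /lin_ext (ssrcomplements.big_mksub 'X_{1..N < d}) /=; first last.
- by move=> x /msize_mdeg_lt /leq_trans; apply.
- exact: msupp_uniq.
by rewrite big_rmcond //= => m; move/memN_msupp_eq0 ->; rewrite scale0r.
Qed.

Lemma lin_extD f g : lin_ext (f + g) = lin_ext f + lin_ext g.
Proof.
set d := maxn (msize f) (msize g).
rewrite !(@lin_ext_bounded d) ?leq_maxl ?leq_maxr ?mmeasureD_le //.
by rewrite -big_split /=; apply: eq_bigr => m _; rewrite mcoeffD scalerDl.
Qed.

Lemma lin_extZ c f : lin_ext (c *: f) = c *: lin_ext f.
Proof.
rewrite !(@lin_ext_bounded (msize f)) ?mmeasureZ_le // scaler_sumr.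
by apply: eq_bigr => m _; rewrite mcoeffZ scalerA.
Qed.

Lemma lin_extX m : lin_ext 'X_[m] = h m.
Proof. by rewrite /lin_ext msuppX big_seq1 mcoeffX eqxx scale1r. Qed.

Lemma lin_ext0 : lin_ext 0 = 0.
Proof. by rewrite -[X in lin_ext X](scale0r 0) lin_extZ scale0r. Qed.

End LinearExtension.

Section MonomialTensor.
Variables (k : fieldType) (a b N : nat).
Local Notation A := {mpoly k[a]}.
Local Notation B := {mpoly k[b]}.
Local Notation R := {mpoly k[N]}.
Variables (iA : {rmorphism A -> R}) (iB : {rmorphism B -> R}).
(* The monomials of R are the products of those of A and those of B: pA and pB
   are the two projections and join is the product. *)
Variables (pA : 'X_{1..N} -> 'X_{1..a}) (pB : 'X_{1..N} -> 'X_{1..b}).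
Variable join : 'X_{1..a} -> 'X_{1..b} -> 'X_{1..N}.
Hypothesis iAZ : forall c p, iA (c *: p) = c *: iA p.
Hypothesis iBZ : forall c p, iB (c *: p) = c *: iB p.
Hypothesis joinK : forall m, join (pA m) (pB m) = m.
Hypothesis pA_join : forall u v, pA (join u v) = u.
Hypothesis pB_join : forall u v, pB (join u v) = v.
Hypothesis iX : forall u v, iA 'X_[u] * iB 'X_[v] = 'X_[join u v].

Lemma monomial_tens_span (f : R) : tens iA iB setT setT f.
Proof.
elim/mpolyind: f => [|c m f _ _ IH]; first by left.
by rewrite -[m]joinK -iX scalerAl -iAZ; apply: tens_cons.
Qed.

(** The map id (x) phi from A (x) B to A, for a linear form phi on B. *)
Definition slice (phi : B -> k) : R -> A :=
  lin_ext (fun m => phi 'X_[pB m] *: 'X_[pA m]).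

Lemma slice_tens (phi : B -> k) p q :
  (forall p q, phi (p + q) = phi p + phi q) ->
  (forall c p, phi (c *: p) = c * phi p) ->
  slice phi (iA p * iB q) = phi q *: p.
Proof.
move=> phiD phiZ; have phi0 : phi 0 = 0 by rewrite -(scale0r 0) phiZ mul0r.
elim/mpolyind: q => [|c v q _ _ IHq].
  by rewrite rmorph0 mulr0 phi0 scale0r; apply: lin_ext0.
rewrite rmorphD mulrDr [LHS]lin_extD -/(slice _) IHq phiD scalerDl.
congr (_ + _); rewrite iBZ phiZ -scalerAr [LHS]lin_extZ -/(slice _) -scalerA.
congr (_ *: _); elim/mpolyind: p {IHq} => [|d u p _ _ IHp].
  by rewrite rmorph0 mul0r scaler0; apply: lin_ext0.
rewrite rmorphD mulrDl [LHS]lin_extD -/(slice _) IHp scalerDr; congr (_ + _).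
rewrite iAZ -scalerAl iX [LHS]lin_extZ lin_extX pA_join pB_join.
by rewrite !scalerA mulrC.
Qed.

Lemma monomial_has_slices V : is_ideal V -> has_slices iA iB V.
Proof.
move=> hV; pose phi v q := (normal_form hV q)@_v.
have phiD v p q : phi v (p + q) = phi v p + phi v q.
  by rewrite /phi normal_formD mcoeffD.
have phiZ v c p : phi v (c *: p) = c * phi v p.
  by rewrite /phi normal_formZ mcoeffZ.
have phiT v p q : slice (phi v) (iA p * iB q) = phi v q *: p.
  by apply: slice_tens.
have sD v f g : slice (phi v) (f + g) = slice (phi v) f + slice (phi v) g.
  exact: lin_extD.
have s0 v : slice (phi v) 0 = 0 by apply: lin_ext0.
exists 'X_{1..b}, (fun v => slice (phi v)), (fun v => 'X_[v]); split=> //.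
- move=> v p f; elim: (monomial_tens_span f) => [|u w x _ _ _ IH].
    by rewrite !mulr0 s0 mulr0.
  by rewrite mulrDr mulrA -rmorphM !sD IH !phiT mulrDr scalerAr.
- move=> U f hU [y [z [Uy Vz ->]]] v; rewrite sD; apply: is_idealD => //.
    elim: Uy => [|u w x Uu _ _ IH]; first by rewrite s0; apply: is_ideal0.
    rewrite sD phiT -mul_mpolyC; apply: is_idealD => //.
    exact: is_idealMl.
  elim: Vz => [|u w x _ Vw Tx IH]; first by rewrite s0; apply: is_ideal0.
  by rewrite sD phiT /phi normal_form_eq0 // mcoeff0 scale0r add0r.
move=> U f hU Uf.
suff [d hd] : exists d, forall d', (d <= d')%N -> tens iA iB U V
    (f - \sum_(v : 'X_{1..b < d'}) iA (slice (phi v) f) * iB 'X_[v]).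
  exists [seq val v | v <- index_enum 'X_{1..b < d}]; rewrite big_map.
  exact: hd.
elim: Uf => [|u w x Uu _ _ [d IH]].
  exists 0%N => d' _; rewrite big1 ?subr0; first by left.
  by move=> v _; rewrite s0 rmorph0 mul0r.
exists (maxn d (msize (normal_form hV w))) => d'; rewrite geq_max => /andP[dd' wd'].
have -> : \sum_(v : 'X_{1..b < d'})
      iA (slice (phi v) (iA u * iB w + x)) * iB 'X_[v] =
    iA u * iB (normal_form hV w) +
    \sum_(v : 'X_{1..b < d'}) iA (slice (phi v) x) * iB 'X_[v].
  rewrite [in RHS](mpolywE wd') rmorph_sum mulr_sumr -big_split /=.
  apply: eq_bigr => v _; rewrite sD phiT rmorphD mulrDl iAZ iBZ.
  by rewrite -scalerAl -scalerAr.
rewrite opprD addrACA -mulrBr -rmorphB; apply: tens_cons => //; last exact: IH.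
by case: (normal_formP hV w).
Qed.

End MonomialTensor.

Lemma split_lshift m n (i : 'I_m) : split (lshift n i) = inl i.
Proof. exact: (unsplitK (inl i)). Qed.

Lemma split_rshift m n (j : 'I_n) : split (rshift m j) = inr j.
Proof. exact: (unsplitK (inr j)). Qed.

Section PolynomialTensor.
Variables (k : fieldType) (n m : nat).
Local Notation A := {mpoly k[n]}.
Local Notation B := {mpoly k[m]}.
Local Notation R := {mpoly k[n + m]}.

(** The inclusions of the two factors, as ring morphisms. *)
Definition inl_morph : {rmorphism A -> R} :=
  comp_mpoly [tuple 'X_(lshift m i) | i < n].

Definition inr_morph : {rmorphism B -> R} :=
  comp_mpoly [tuple 'X_(rshift n j) | j < m].

Let pA (w : 'X_{1..n + m}) : 'X_{1..n} := [multinom w (lshift m i) | i < n].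
Let pB (w : 'X_{1..n + m}) : 'X_{1..m} := [multinom w (rshift n j) | j < m].
Let join (u : 'X_{1..n}) (v : 'X_{1..m}) : 'X_{1..n + m} :=
  [multinom match split i with inl i => u i | inr j => v j end | i < n + m].

Let joinK w : join (pA w) (pB w) = w.
Proof.
apply/mnmP=> i; rewrite mnmE; case: (split_ordP i) => j ->.
  by rewrite mnmE.
by rewrite mnmE.
Qed.

Let pA_join u v : pA (join u v) = u.
Proof. by apply/mnmP=> i; rewrite !mnmE split_lshift. Qed.

Let pB_join u v : pB (join u v) = v.
Proof. by apply/mnmP=> i; rewrite !mnmE split_rshift. Qed.

Let iX u v : inl_morph 'X_[u] * inr_morph 'X_[v] = 'X_[join u v].
Proof.
rewrite /= !comp_mpolyX [in RHS]mpolyXE_id big_split_ord /=; congr (_ * _).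
  by apply: eq_bigr => i _; rewrite tnth_mktuple mnmE split_lshift.
by apply: eq_bigr => i _; rewrite tnth_mktuple mnmE split_rshift.
Qed.

Lemma poly_tens_span (f : R) : tens inl_morph inr_morph setT setT f.
Proof. by apply: (monomial_tens_span _ joinK iX) => c p; apply: comp_mpolyZ. Qed.

Lemma poly_slices_right (V : set B) :
  is_ideal V -> has_slices inl_morph inr_morph V.
Proof.
by apply: (monomial_has_slices _ _ joinK pA_join pB_join iX) => c p;
  apply: comp_mpolyZ.
Qed.

Lemma poly_slices_left (U : set A) :
  is_ideal U -> has_slices inr_morph inl_morph U.
Proof.
apply: (@monomial_has_slices _ _ _ _ _ _ pB pA (fun v u => join u v)) => //.
- by move=> c p; apply: comp_mpolyZ.
- by move=> c p; apply: comp_mpolyZ.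
- by move=> v u; rewrite mulrC.
Qed.

Lemma ideal_sum_qid (I : set A) (J : set B) : is_ideal I -> is_ideal J ->
  ideal_sum I J = qid inl_morph inr_morph I J.
Proof.
move=> hI hJ; have hS := qid_ideal poly_tens_span hI hJ.
apply/seteqP; split.
  apply: ideal_gen_min => // _ [[p Ip <-]|[q Jq <-]].
    apply: tens_qidl; rewrite -[tensor_inl m p]mulr1 -(rmorph1 inr_morph).
    exact: (mem_tens inl_morph inr_morph).
  apply: tens_qidr; rewrite -[tensor_inr n q]mul1r -(rmorph1 inl_morph).
  exact: (mem_tens inl_morph inr_morph).
have hG : is_ideal (ideal_sum I J) by apply: ideal_gen_ideal.
move=> _ [y [z [Iy Jz ->]]]; apply: (is_idealD hG).
  apply: (tens_sub hG _ Iy) => u v Iu _; apply: (is_idealMr _ hG).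
  by apply: sub_ideal_gen; left; exists u.
apply: (tens_sub hG _ Jz) => u v _ Jv; apply: (is_idealMl _ hG).
by apply: sub_ideal_gen; right; exists v.
Qed.

(** The retractions of the tensor product onto its factors: the variables of
    the other factor are sent to 0. *)
Definition retract_left : {rmorphism R -> A} := comp_mpoly
  [tuple match split i with inl i => 'X_i | inr _ => 0 end | i < n + m].

Definition retract_right : {rmorphism R -> B} := comp_mpoly
  [tuple match split i with inl _ => 0 | inr j => 'X_j end | i < n + m].

End PolynomialTensor.

(** The composite of two substitutions that fixes the variables is the
    identity. *)
Lemma comp_mpolyK (k : fieldType) (a N : nat) (s : a.-tuple {mpoly k[N]})
    (t : N.-tuple {mpoly k[a]}) :
  (forall i, tnth s i \mPo t = 'X_i) -> cancel (comp_mpoly s) (comp_mpoly t).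
Proof.
move=> st p; elim/mpolyind: p => [|c m p _ _ IH].
  by rewrite (comp_mpoly0 s) comp_mpoly0.
rewrite (comp_mpolyD s) comp_mpolyD {}IH (comp_mpolyZ _ _ s) comp_mpolyZ.
congr (_ *: _ + _); rewrite comp_mpolyX rmorph_prod mpolyXE_id.
by apply: eq_bigr => i _; rewrite rmorphXn /= st.
Qed.

(** A composite of two substitutions that sends the variables to 0 leaves the
    constant term. *)
Lemma comp_mpoly_const (k : fieldType) (a N c : nat) (s : a.-tuple {mpoly k[N]})
    (t : N.-tuple {mpoly k[c]}) p : (forall i, tnth s i \mPo t = 0) ->
  comp_mpoly t (comp_mpoly s p) = (p@_0%MM)%:MP.
Proof.
move=> st; elim/mpolyind: p => [|d m p _ _ IH].
  by rewrite (comp_mpoly0 s) comp_mpoly0 mcoeff0.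
rewrite (comp_mpolyD s) comp_mpolyD {}IH (comp_mpolyZ _ _ s) comp_mpolyZ.
rewrite mcoeffD mcoeffZ mcoeffX mpolyCD; congr (_ + _).
rewrite comp_mpolyX rmorph_prod /=; have [->|m0] := eqVneq m 0%MM.
  rewrite big1 ?mulr1 => [|i _]; first by rewrite -alg_mpolyC.
  by rewrite mnm0E expr0 rmorph1.
have [i mi] : exists i, m i != 0%N.
  apply: contrapT => h; move/eqP: m0; apply; apply/mnmP => i; rewrite mnm0E.
  by apply/eqP; apply: contrapT => mi; apply: h; exists i; apply/negP.
rewrite (bigD1 i) //= rmorphXn /= st expr0n (negPf mi) mul0r scaler0.
by rewrite mulr0 mpolyC0.
Qed.

Lemma tnthX_comp (k : fieldType) (a N : nat) (i : 'I_N) (t : N.-tuple {mpoly k[a]}) :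
  'X_i \mPo t = tnth t i.
Proof. by rewrite comp_mpolyXU (tnth_nth 0). Qed.

Section Retractions.
Variables (k : fieldType) (n m : nat).

Lemma inlK : cancel (inl_morph k n m) (retract_left k n m).
Proof.
by apply: comp_mpolyK => i; rewrite tnth_mktuple tnthX_comp tnth_mktuple split_lshift.
Qed.

Lemma inrK : cancel (inr_morph k n m) (retract_right k n m).
Proof.
by apply: comp_mpolyK => i; rewrite tnth_mktuple tnthX_comp tnth_mktuple split_rshift.
Qed.

Lemma retract_left_inr p : retract_left k n m (inr_morph k n m p) = (p@_0%MM)%:MP.
Proof.
by apply: comp_mpoly_const => i; rewrite tnth_mktuple tnthX_comp tnth_mktuple split_rshift.
Qed.

Lemma retract_right_inl p : retract_right k n m (inl_morph k n m p) = (p@_0%MM)%:MP.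
Proof.
by apply: comp_mpoly_const => i; rewrite tnth_mktuple tnthX_comp tnth_mktuple split_lshift.
Qed.

End Retractions.

(** * Orders of vanishing at the origin *)

Section Order.
Variables (k : fieldType) (n : nat).
Implicit Types (p q : {mpoly k[n]}) (I : set {mpoly k[n]}).

(** The d-th power of the maximal homogeneous ideal: the polynomials all of
    whose monomials have degree at least d. *)
Definition order_ge d : set {mpoly k[n]} :=
  [set p | forall m, (mdeg m < d)%N -> p@_m = 0].

Lemma order_geM d e p q : order_ge d p -> order_ge e q -> order_ge (d + e) (p * q).
Proof.
move=> hp hq m; rewrite mcoeffM => md; apply: big1 => -[u v] /= /eqP muv.
case: (ltnP (mdeg u) d) => ud; first by rewrite hp ?mul0r.
case: (ltnP (mdeg v) e) => ve; first by rewrite hq ?mulr0.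
have : (mdeg (u + v) < d + e)%N by rewrite -muv.
by rewrite mdegD ltnNge leq_add.
Qed.

Lemma order_ge_ideal d : is_ideal (order_ge d).
Proof.
split=> [m _|p q hp hq m md|a p hp]; first exact: mcoeff0.
  by rewrite mcoeffD hp // hq // addr0.
by rewrite -[d]add0n; apply: order_geM.
Qed.

Lemma ideal_exp_order I d r : I `<=` order_ge d -> ideal_exp I r `<=` order_ge (d * r).
Proof.
move=> Id; elim: r => [|r IHr]; first by rewrite muln0 => p _ m.
apply: ideal_gen_min => [|_ [p [q [Ip Iq ->]]]]; first exact: order_ge_ideal.
by rewrite mulnS; apply: order_geM; [apply: Id|apply: IHr].
Qed.

Lemma order_ge_msize d p : (msize p <= d)%N -> order_ge d p -> p = 0.
Proof.
move=> pd hp; apply/mpolyP => m; rewrite mcoeff0.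
case: (ltnP (mdeg m) d) => md; first exact: hp.
by apply: memN_msupp_eq0; apply: msize_mdeg_ge; apply: leq_trans md.
Qed.

Lemma mcoeff_pihomog d p u : (pihomog mdeg d p)@_u = if mdeg u == d then p@_u else 0.
Proof.
elim/mpolyind: p => [|c v p _ _ IH].
  by rewrite pihomog0 !mcoeff0 if_same.
rewrite pihomogD linearZ /= pihomogX !mcoeffD IH !mcoeffZ.
case: ifP => vd; rewrite !(mcoeffX, mcoeff0); have [<-|_] := eqVneq v u;
  rewrite ?vd ?mulr0 ?add0r //; by case: ifP => // _; rewrite add0r.
Qed.

Lemma homogeneous_mcoeff0 I p : nonzero_proper_homogeneous I -> I p -> p@_0%MM = 0.
Proof.
move=> [[hI homI] _ nI1] /(homI 0%N) Ip0.
apply/eqP; apply: contrapT => /negP p0; apply: nI1.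
have -> : 1 = (p@_0%MM)^-1%:MP * pihomog mdeg 0 p; last exact: is_idealMl.
apply/mpolyP => u; rewrite mcoeffCM mcoeff_pihomog mcoeff1 mdeg_eq0.
by case: eqP => [->|_]; rewrite ?mulVf ?mulr0.
Qed.

Lemma homogeneous_order1 I : nonzero_proper_homogeneous I -> I `<=` order_ge 1.
Proof.
move=> hI p Ip m; rewrite ltnS leqn0 mdeg_eq0 => /eqP->.
exact: homogeneous_mcoeff0 hI Ip.
Qed.

(** Only finitely many powers of I contain a given symbolic power. *)
Lemma symbolic_power_not_sub I i : nonzero_proper_homogeneous I ->
  exists r, ~ symbolic_power I i `<=` ideal_exp I r.
Proof.
move=> hI; have [_ [p Ip p0] _] := hI.
exists (msize (p ^+ i)) => sub; have /eqP := expf_neq0 i p0; apply.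
apply: (@order_ge_msize (msize (p ^+ i))) => //.
rewrite -[msize _]mul1n; apply: ideal_exp_order (homogeneous_order1 hI) _ _.
by apply: sub; apply: ideal_exp_sub_symbolic; apply: mem_ideal_expX.
Qed.

End Order.

(** * Bounds on the resurgence of a sum *)

Section Resurgence.
Variable R : realType.

Lemma resurgence_ge (A : idomainType) (I : set A) m r : (0 < m)%N -> (0 < r)%N ->
  ~ symbolic_power I m `<=` ideal_exp I r ->
  ((m%:R / r%:R)%:E <= resurgence R I)%E.
Proof.
by move=> m0 r0 nsub; apply: ereal_sup_ubound; exists m, r.
Qed.

Lemma resurgence_ge0 (k : fieldType) n (I : set {mpoly k[n]}) :
  nonzero_proper_homogeneous I -> (0 <= resurgence R I)%E.
Proof.
move=> hI; have [r nsub] := symbolic_power_not_sub 1 hI.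
case: r nsub => [[]//|r nsub].
by apply: le_trans (resurgence_ge _ _ nsub) => //; rewrite lee_fin divr_ge0.
Qed.

(** Here a.+1 is the first exponent such that the i-th symbolic power of I is
    not in that power of I; it is at least 2 for positive i, as the i-th
    symbolic power then lies in I. *)
Lemma first_missed_power (k : fieldType) n (I : set {mpoly k[n]}) i :
  nonzero_proper_homogeneous I -> exists a,
  [/\ symbolic_power I i `<=` ideal_exp I a,
      (0 < i)%N -> (0 < a)%N
    & (0 < i)%N -> ((i%:R / a.+1%:R)%:E <= resurgence R I)%E].
Proof.
move=> hI; have ex_r : exists r, `[< ~ symbolic_power I i `<=` ideal_exp I r >].
  have [r nsub] := symbolic_power_not_sub i hI; by exists r; apply/asboolP.
case: (ex_minnP ex_r) => -[|a] /asboolP nsub rmin; first by case: nsub.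
exists a; split.
- apply: contrapT => nsuba; have := rmin a; rewrite ltnn.
  by move/(_ (introT (asboolP _) nsuba)).
- move=> i_gt0; case: a nsub {rmin} => // -[].
  have [[hII _] _ _] := hI.
  by rewrite ideal_exp1 //; apply: symbolic_power_sub => //; apply: mpoly_noetherian.
- by move=> i_gt0; apply: resurgence_ge.
Qed.

(** The real inequality behind the upper bound. For a, b > 0, with M the right
    hand side, x (a + 1) + y (b + 1) = 2 (x + y) + x (a - 1) + y (b - 1) is at
    most 3 M + M (a - 1) + M (b - 1) = M (a + b + 1). *)
Lemma ratio_le_max (x y : R) (i j a b r : nat) : 0 <= x -> 0 <= y ->
  (0 < i + j)%N -> (a + b < r)%N ->
  ((0 < i)%N -> (0 < a)%N) -> ((0 < j)%N -> (0 < b)%N) ->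
  ((0 < i)%N -> i%:R / a.+1%:R <= x) -> ((0 < j)%N -> j%:R / b.+1%:R <= y) ->
  (i + j)%:R / r%:R <= Num.max (Num.max x y) (2 * (x + y) / 3).
Proof.
move=> x0 y0 ij abr a0 b0 hx hy; set M := Num.max _ _.
have xM : x <= M by rewrite !le_max lexx.
have yM : y <= M by rewrite !le_max lexx orbT.
have xyM : 2 * (x + y) / 3 <= M by rewrite le_max lexx orbT.
have r_gt0 : 0 < r%:R :> R by rewrite ltr0n; case: r abr.
have hr : a%:R + b%:R + 1 <= r%:R :> R by rewrite -natrD natr1 ler_nat.
rewrite ler_pdivrMr // natrD.
have M0 : 0 <= M by lra.
have Mr : M * (a%:R + b%:R + 1) <= M * r%:R by apply: ler_wpM2l.
apply: le_trans Mr.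
have a_ge0 : 0 <= a%:R :> R by [].
have b_ge0 : 0 <= b%:R :> R by [].
have {}hx : (0 < i)%N -> i%:R <= x * (a%:R + 1).
  by move=> /hx; rewrite ler_pdivrMr // natr1.
have {}hy : (0 < j)%N -> j%:R <= y * (b%:R + 1).
  by move=> /hy; rewrite ler_pdivrMr // natr1.
have [i0|i_gt0] := posnP i.
  rewrite i0 add0r; apply: le_trans (hy _) _; first by rewrite i0 in ij.
  by nra.
have [j0|j_gt0] := posnP j.
  by rewrite j0 addr0; apply: le_trans (hx i_gt0) _; nra.
have a1 : 1 <= a%:R :> R by rewrite ler1n a0.
have b1 : 1 <= b%:R :> R by rewrite ler1n b0.
have := hx i_gt0; have := hy j_gt0.
have := ler_wpM2r (_ : 0 <= a%:R - 1) xM; have := ler_wpM2r (_ : 0 <= b%:R - 1) yM.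
by rewrite !subr_ge0 => /(_ b1) ? /(_ a1) ? ? ?; lra.
Qed.

(** When one number is at least twice the other, the third term of the upper
    bound is at most the larger one. *)
Lemma third_term_le (x y : \bar R) : (0 <= x)%E -> (0 <= y)%E ->
  (2%:E * mine x y <= maxe x y)%E -> (2%:E * (x + y) / 3%:E <= maxe x y)%E.
Proof.
case: x => [x| |]; case: y => [y| |] //;
  try by move=> *; rewrite (le_trans (leey _)) // !le_max lexx ?orbT.
rewrite -EFinD -EFinM inver pnatr_eq0 /= -!EFin_max -EFin_min -EFinM !lee_fin.
by case: (lerP x y) => *; lra.
Qed.

Section Sum.
Variables (k : fieldType) (n m : nat).
Variables (I : set {mpoly k[n]}) (J : set {mpoly k[m]}).
Hypotheses (hI : nonzero_proper_homogeneous I) (hJ : nonzero_proper_homogeneous J).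

Let idI : is_ideal I. Proof. by case: hI => -[]. Qed.
Let idJ : is_ideal J. Proof. by case: hJ => -[]. Qed.

Lemma resurgence_sum_ge_left : (resurgence R I <= resurgence R (ideal_sum I J))%E.
Proof.
apply: ub_ereal_sup => _ [s [r [s0 r0 nsub ->]]]; apply: resurgence_ge => // sub.
apply: nsub => p Ip; rewrite ideal_sum_qid // in sub.
apply: (ideal_exp_inl idI (@inlK k n m) _ (sub _ _)).
  by move=> q Jq; rewrite retract_left_inr (homogeneous_mcoeff0 hJ Jq) mpolyC0.
apply: symbolic_power_inl => //; [exact: poly_tens_span|exact: poly_slices_right].
Qed.

Lemma resurgence_sum_ge_right : (resurgence R J <= resurgence R (ideal_sum I J))%E.
Proof.
apply: ub_ereal_sup => _ [s [r [s0 r0 nsub ->]]]; apply: resurgence_ge => // sub.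
apply: nsub => q Jq; rewrite ideal_sum_qid // qid_swap in sub.
apply: (ideal_exp_inl idJ (@inrK k n m) _ (sub _ _)).
  by move=> p Ip; rewrite retract_right_inl (homogeneous_mcoeff0 hI Ip) mpolyC0.
apply: symbolic_power_inl => // [f|]; last exact: poly_slices_left.
by apply: tens_swap; apply: poly_tens_span.
Qed.

(** If the s-th symbolic power of the sum is not in its r-th power, then
    some product of elements of the i-th and the j-th symbolic powers, i + j = s,
    is not either; so a + b < r whenever these symbolic powers lie in I^a and
    J^b. *)
Lemma ideal_sum_missed_power s r :
  ~ symbolic_power (ideal_sum I J) s `<=` ideal_exp (ideal_sum I J) r ->
  exists i j, (i + j)%N = s /\ forall a b, symbolic_power I i `<=` ideal_exp I a ->
    symbolic_power J j `<=` ideal_exp J b -> (a + b < r)%N.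
Proof.
rewrite ideal_sum_qid // => nsub; apply: contrapT => h; apply: nsub.
have hS := qid_ideal (@poly_tens_span k n m) idI idJ.
apply: symbolic_power_sum_sub => //.
- exact: poly_tens_span.
- exact: poly_slices_right.
- exact: poly_slices_left.
- exact: mpoly_noetherian.
- exact: mpoly_noetherian.
- exact: mpoly_noetherian.
- exact: ideal_exp_ideal.
move=> i j u v ij Iu Jv; apply: contrapT => nS; apply: h; exists i, j; split=> // a b.
move=> Ia Jb; rewrite ltnNge; apply/negP => rab; apply: nS.
apply: (ideal_exp_le hS rab).
by apply: mem_qid_exp; [apply: Ia|apply: Jb].
Qed.

Lemma resurgence_sum_le : (resurgence R (ideal_sum I J) <=
  maxe (maxe (resurgence R I) (resurgence R J))
       (2%:E * (resurgence R I + resurgence R J) / 3%:E))%E.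
Proof.
apply: ub_ereal_sup => _ [s [r [s0 r0 nsub ->]]].
have [i [j [ij hr]]] := ideal_sum_missed_power nsub.
have [a [Ia a0 ha]] := first_missed_power i hI.
have [b [Jb b0 hb]] := first_missed_power j hJ.
have {hr}abr := hr a b Ia Jb.
move: ha hb (resurgence_ge0 hI) (resurgence_ge0 hJ).
case: (resurgence R I) => [x| |]; case: (resurgence R J) => [y| |] //;
  try by move=> *; rewrite (le_trans (leey _)) // !le_max lexx ?orbT.
rewrite !lee_fin => hx hy x0 y0.
rewrite -EFinD -EFinM inver pnatr_eq0 /= -!EFin_max lee_fin -ij.
by rewrite -ij in s0; apply: (@ratio_le_max x y i j a b r).
Qed.

Lemma resurgence_sum_eq :
  (2%:E * mine (resurgence R I) (resurgence R J) <=
    maxe (resurgence R I) (resurgence R J))%E ->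
  resurgence R (ideal_sum I J) = maxe (resurgence R I) (resurgence R J).
Proof.
move=> h; apply/eqP; rewrite eq_le ge_max resurgence_sum_ge_left.
rewrite resurgence_sum_ge_right /= andbT; apply: le_trans resurgence_sum_le _.
by rewrite ge_max lexx /= third_term_le ?resurgence_ge0.
Qed.

End Sum.
End Resurgence.

(** * An example attaining the upper bound *)

Section MaximalIdeal.
Variables (k : fieldType) (n : nat).
Local Notation M := (@order_ge k n 1).

Lemma mem_maximal p : M p <-> p@_0%MM = 0.
Proof.
split=> [|p0 m]; first by apply; rewrite mdeg0.
by rewrite ltnS leqn0 mdeg_eq0 => /eqP->.
Qed.

Lemma order_ge_homogeneous d : homogeneous_ideal (@order_ge k n d).
Proof.
split=> [|e p hp m md]; first exact: order_ge_ideal.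
by rewrite mcoeff_pihomog hp // if_same.
Qed.

Lemma order_ge_sub_exp r : @order_ge k n r `<=` ideal_exp M r.
Proof.
move=> p hp; have hM := order_ge_ideal k n 1.
rewrite (mpolyE p); apply: is_ideal_sum; first exact: ideal_exp_ideal.
move=> m _; case: (ltnP (mdeg m) r) => mr.
  by rewrite hp // scale0r; apply: is_ideal0; apply: ideal_exp_ideal.
rewrite -mul_mpolyC; apply: is_idealMl; first exact: ideal_exp_ideal.
apply: (ideal_exp_le hM mr); rewrite mpolyXE_id mdegE.
apply: (big_rec2 (fun d q => ideal_exp M d q)) => // i d q _ Mq.
apply: mem_ideal_expM => //; apply: mem_ideal_expX => w.
by rewrite ltnS leqn0 mdeg_eq0 => /eqP->; rewrite mcoeffX mnm1_eq0.
Qed.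

Lemma maximal_prime : is_prime_ideal M.
Proof.
split; first exact: order_ge_ideal.
  by move/mem_maximal/eqP; rewrite mcoeff1 eqxx oner_eq0.
move=> p q /mem_maximal/eqP; rewrite rmorphM mulf_eq0 => /orP[] /eqP h.
  by left; apply/mem_maximal.
by right; apply/mem_maximal.
Qed.

Lemma maximal_associated : associated_prime M M.
Proof.
split; first exact: maximal_prime.
by exists 1; apply/seteqP; split=> p; rewrite /= mulr1.
Qed.

(** Multiplication by a polynomial with nonzero constant term does not raise the
    order. *)
Lemma order_ge_unit d s p : ~ M s -> order_ge d (s * p) -> order_ge d p.
Proof.
move=> nMs hsp; have s0 : s@_0%MM != 0 by apply/eqP => /mem_maximal.
suff : forall e, (e <= d)%N -> order_ge e p by apply.
elim=> [_ m //|e IHe ed m me]; apply: (mulfI s0).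
rewrite -mcoeffCM mulr0.
have -> : (s@_0%MM)%:MP * p = s * p - (s - (s@_0%MM)%:MP) * p by ring.
rewrite mcoeffB hsp ?(leq_trans me) // sub0r.
rewrite (@order_geM _ _ 1 e) ?oppr0 //; last exact: IHe (ltnW ed).
by apply/mem_maximal; rewrite mcoeffB mcoeffC eqxx mulr1 subrr.
Qed.

Lemma maximal_resurgence_le (R : realType) : (resurgence R M <= 1)%E.
Proof.
apply: ub_ereal_sup => _ [m [r [m0 r0 nsub ->]]].
rewrite lee_fin ler_pdivrMr ?ltr0n // mul1r ler_nat leqNgt; apply/negP => rm.
apply: nsub => p /(symbolic_power_le (order_ge_ideal k n 1) (ltnW rm)) Mp.
apply: order_ge_sub_exp.
have hM := ideal_exp_ideal M r.
have /contractionP[||s nMs Ms] := Mp _ maximal_associated => //.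
  exact: maximal_prime.
apply: order_ge_unit nMs _; rewrite -[r]mul1n.
exact: ideal_exp_order Ms.
Qed.

End MaximalIdeal.

Section StarIdeal.
Variable k : fieldType.
Local Notation R7 := {mpoly k[7]}.

(** The set of the variables that occur in a monomial. *)
Definition msupport (m : 'X_{1..7}) : {set 'I_7} := finset (fun i => m i != 0%N).

(** The ideal of k[x_1, ..., x_7] generated by the squarefree monomials of
    degree 4, which is the intersection of the ideals generated by four
    variables: the polynomials whose monomials involve at least 4 variables. *)
Definition star : set R7 := [set p | forall m, (#|msupport m| < 4)%N -> p@_m = 0].

Lemma star_ideal : is_ideal star.
Proof.
split=> [m _|p q hp hq m hm|a p hp m hm]; first exact: mcoeff0.
  by rewrite mcoeffD hp // hq // addr0.
rewrite mcoeffM; apply: big1 => -[u v] /= /eqP muv; rewrite [p@__]hp ?mulr0 //.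
apply: leq_ltn_trans hm; apply: subset_leq_card; apply/fintype.subsetP => i.
rewrite !inE; have := congr1 (fun w : 'X_{1..7} => w i) muv.
by rewrite mnmDE => -> vi; rewrite addn_eq0 negb_and vi orbT.
Qed.

Lemma starX m : (3 < #|msupport m|)%N -> star 'X_[m].
Proof.
move=> m4 u um; rewrite mcoeffX; case: eqVneq => // mu.
by move: um; rewrite -mu ltnNge m4.
Qed.

Lemma star_order4 : star `<=` order_ge 4.
Proof.
move=> p hp m md; apply: hp; apply: leq_ltn_trans md.
rewrite mdegE -sum1_card big_mkcond; apply: leq_sum => i _.
by rewrite inE; case: (m i).
Qed.

Lemma msupportU i u : msupport (U_(i) + u)%MM = (i |: msupport u)%SET.
Proof.
apply/setP => j; rewrite !inE mnmDE mnm1E addn_eq0 negb_and eqb0 negbK.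
by rewrite eq_sym.
Qed.

(** The monomial x_1 ... x_7. *)
Definition all_vars : 'X_{1..7} := [multinom 1%N | i < 7].

Lemma card_msupport_all : #|msupport all_vars| = 7%N.
Proof.
rewrite -[RHS]card_ord; apply: eq_card => i.
by rewrite inE mnmE.
Qed.

Lemma star_homogeneous : nonzero_proper_homogeneous star.
Proof.
split; first split.
- exact: star_ideal.
- by move=> d p hp m hm; rewrite mcoeff_pihomog hp // if_same.
- exists 'X_[all_vars]; first by apply: starX; rewrite card_msupport_all.
  apply/eqP => /mpolyP/(_ all_vars)/eqP.
  by rewrite mcoeffX eqxx mcoeff0 oner_eq0.
move=> /(_ 0%MM); rewrite mcoeff1 eqxx eq_card0 => [/(_ isT)/eqP|i].
  by rewrite oner_eq0.
by rewrite inE mnm0E.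
Qed.

(** An associated prime of the star ideal contains at most 4 variables: if it
    annihilates the class of g and u is a monomial of g outside the ideal, then
    the variables of the prime do not occur in u, and if there are any, then u
    involves 3 variables. *)
Lemma star_associated_card (P : set R7) : associated_prime star P ->
  (#|[pred i : 'I_7 | `[< P 'X_i >]]| <= 4)%N.
Proof.
move=> [[_ nP1 _] [g defP]].
have [u [u4 gu]] : exists u, (#|msupport u| < 4)%N /\ g@_u <> 0.
  apply: contrapT => h; apply: nP1; rewrite defP /= mul1r => u u4.
  by apply: contrapT => gu; apply: h; exists u.
have uP i : P 'X_i -> i \notin msupport u /\ #|msupport u| = 3%N.
  rewrite defP /= => /(_ (u + U_(i))%MM); rewrite mulrC addmC mcoeffMX => hi.
  have : (3 < #|msupport (U_(i) + u)%MM|)%N by rewrite ltnNge -ltnS; apply/negP => /hi.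
  rewrite msupportU cardsU1; case: (i \in msupport u) ; rewrite ?add0n ?add1n => h.
    by move: u4; rewrite ltnNge h.
  by split=> //; apply/eqP; rewrite eqn_leq -ltnS u4.
have [/pred0P Z0|/pred0Pn[i]] := boolP (pred0b [pred i : 'I_7 | `[< P 'X_i >]]).
  by rewrite eq_card0.
rewrite inE => /asboolP/uP[_ u3].
apply: (@leq_trans #|(~: msupport u)%SET|); last by rewrite cardsCs finset.setCK card_ord u3.
apply: subset_leq_card; apply/fintype.subsetP => j.
by rewrite inE => Zj; rewrite finset.inE; case: (uP j Zj).
Qed.

(** Outside an associated prime the at least 3 other variables are invertible,
    so each variable of the prime, as well as 1 if there are fewer than 4 of
    them, lies in the localization of the star ideal. *)
Lemma all_vars_symbolic : symbolic_power star 4 'X_[all_vars].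
Proof.
move=> P PI; have [pP _] := PI; have hS := star_ideal.
apply/contractionP => //; first exact: ideal_exp_ideal.
pose Z := [pred i : 'I_7 | `[< P 'X_i >]].
have Z4 : (#|Z| <= 4)%N by apply: star_associated_card.
pose D : 'X_{1..7} := [multinom (i \notin Z : nat) | i < 7].
have defD : 'X_[D] = \prod_(i | i \notin Z) 'X_i :> R7.
  rewrite mpolyXE_id [RHS]big_mkcond /=; apply: eq_bigr => i _.
  by rewrite mnmE; case: (i \notin Z).
have nPD : ~ P 'X_[D].
  rewrite defD; apply: (big_ind (fun x => ~ P x)) => [|x y|i].
  - by case: pP.
  - exact: primeM.
  - by rewrite inE => /asboolPn.
have cardD : #|msupport D| = (7 - #|Z|)%N.
  apply/eqP; rewrite -(eqn_add2l #|Z|) subnKC ?(leq_trans Z4) //.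
  have -> : #|msupport D| = #|predC Z|.
    by apply: eq_card => i; rewrite !inE mnmE; case: (_ \notin _).
  by rewrite cardC card_ord.
exists ('X_[D] ^+ 3); first by do 2!(apply: primeM => //).
have -> : 'X_[D] ^+ 3 * 'X_[all_vars] =
    'X_[D] ^+ (4 - #|Z|) * \prod_(i in Z) ('X_[D] * 'X_i) :> R7.
  rewrite big_split /= prodr_const mulrA -exprD subnK //.
  rewrite [in RHS]exprSr -mulrA; congr (_ * _); rewrite defD mpolyXE_id.
  rewrite mulrC (bigID (mem Z)) /=.
  by congr (_ * _); apply: eq_bigr => i _; rewrite mnmE.
rewrite -[X in ideal_exp _ X](subnK Z4); apply: mem_ideal_expM.
  have [->|Z4'] := eqVneq #|Z| 4%N; first by [].
  apply: mem_ideal_expX; apply: starX; rewrite cardD; lia.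
rewrite -sum1_card; apply: (big_rec2 (fun d q => ideal_exp star d q)) => // i d q Zi Sq.
apply: (@mem_ideal_expM _ _ 1) => //; rewrite ideal_exp1 // -mpolyXD.
apply: starX; rewrite addmC msupportU cardsU1 cardD finset.inE mnmE Zi /=.
by lia.
Qed.

Lemma star_resurgence_ge (R : realType) : (2%:E <= resurgence R star)%E.
Proof.
have -> : 2%:E = (4%:R / 2%:R)%:E :> \bar R by congr EFin; field.
apply: resurgence_ge => // sub.
suff deg7 : (mdeg all_vars < 4 * 2)%N.
  have /eqP := ideal_exp_order star_order4 (sub _ all_vars_symbolic) deg7.
  by rewrite mcoeffX eqxx oner_eq0.
rewrite mdegE (eq_bigr (fun=> 1%N)) => [|i _]; last by rewrite mnmE.
by rewrite sum1_card card_ord.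
Qed.

End StarIdeal.

(** For the star ideal and the maximal ideal of k[y], the resurgences are at
    least 2 and at most 1, respectively, so both sides are the first one. *)
Lemma resurgence_bound_attained (R : realType) (k : fieldType) :
  let I := @star k in let J := @order_ge k 1 1 in
  [/\ nonzero_proper_homogeneous I, nonzero_proper_homogeneous J
    & resurgence R (ideal_sum I J) =
      maxe (maxe (resurgence R I) (resurgence R J))
           (2%:E * (resurgence R I + resurgence R J) / 3%:E)%E].
Proof.
move=> I J; have hI : nonzero_proper_homogeneous I := star_homogeneous k.
have hJ : nonzero_proper_homogeneous J.
  split; first exact: order_ge_homogeneous.
    exists 'X_ord0; first by apply/mem_maximal; rewrite mcoeffX mnm1_eq0.
    by apply/eqP => /mpolyP/(_ U_(ord0)%MM)/eqP;
      rewrite mcoeffXU eqxx mcoeff0 oner_eq0.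
  by case: (maximal_prime k 1).
split=> //; have h2 : (2%:E * mine (resurgence R I) (resurgence R J) <=
    maxe (resurgence R I) (resurgence R J))%E.
  rewrite le_max; apply/orP; left; apply: le_trans (star_resurgence_ge k R).
  rewrite -[leRHS]mule1; apply: lee_wpmul2l; first by rewrite lee_fin.
  by rewrite ge_min maximal_resurgence_le orbT.
rewrite resurgence_sum_eq //; apply/esym/max_idPl.
by apply: third_term_le => //; apply: resurgence_ge0.
Qed.

Local Open Scope ereal_scope.

Theorem theorem1p2 (R : realType) (k : fieldType) :
  (forall (n m : nat) (I : set {mpoly k[n]}) (J : set {mpoly k[m]}),
     nonzero_proper_homogeneous I -> nonzero_proper_homogeneous J ->
     let rI := resurgence R I in
     let rJ := resurgence R J in
     let rIJ := resurgence R (ideal_sum I J) in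
     [/\ maxe rI rJ <= rIJ,
         rIJ <= maxe (maxe rI rJ) (2%:E * (rI + rJ) / 3%:E)
       & 2%:E * mine rI rJ <= maxe rI rJ -> rIJ = maxe rI rJ])
  /\
  (exists (n m : nat) (I : set {mpoly k[n]}) (J : set {mpoly k[m]}),
     let rI := resurgence R I in
     let rJ := resurgence R J in
     let rIJ := resurgence R (ideal_sum I J) in
     [/\ nonzero_proper_homogeneous I, nonzero_proper_homogeneous J
       & rIJ = maxe (maxe rI rJ) (2%:E * (rI + rJ) / 3%:E)]).
Proof.
split=> [n m I J hI hJ rI rJ rIJ|].
  split; last exact: resurgence_sum_eq.
    by rewrite ge_max resurgence_sum_ge_left // resurgence_sum_ge_right.
  exact: resurgence_sum_le.
exists 7%N, 1%N, (@star k), (@order_ge k 1 1).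
exact: resurgence_bound_attained.
Qed.
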